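(* Let $n\in\mathbb{N}$, let $a<b$, and let $p,q\in[1,\infty]$ be conjugate exponents. Let $f\colon[a,b]\to\mathbb{R}$ be such that $f^{(n-1)}$ is absolutely continuous on $[a,b]$ and $f^{(n)}\in L^p([a,b])$. Let $\phi_n$ be a monic polynomial of degree $n$. Then $$\int_a^b f(x)\,dx = \frac{(-1)^n}{n!}\sum_{k=0}^{n-1}(-1)^{n-k-1}\left[\phi_n^{(n-k-1)}(a)f^{(k)}(a)- \phi_n^{(n-k-1)}(b)f^{(k)}(b)\right]+E_n(f),$$ where $E_n(f)=\frac{(-1)^n}{n!}\int_a^b f^{(n)}(x)\phi_n(x)\,dx$. Write $\phi_n(x)=\left(\frac{b-a}{2}\right)^n\tilde\phi_n\!\left(\frac{2x-a-b}{b-a}\right)$, so that $\tilde\phi_n$ is a monic polynomial of degree $n$, and set $K_{n,p}=2^{-n-1/q}\|\tilde\phi_n\|_{q}/n!$, where $\|\tilde\phi_n\|_q$ denotes the $L^q$ norm over $[-1,1]$ (the maximum of $|\tilde\phi_n|$ on $[-1,1]$ if $q=\infty$). Then $$|E_n(f)|\leq \frac{\|f^{(n)}\|_p\|\phi_n\|_q}{n!}\leq K_{n,p}\|f^{(n)}\|_p(b-a)^{n+1/q},$$ where the norms $\|f^{(n)}\|_p$, $\|\phi_n\|_q$ are over $[a,b]$; the constant $K_{n,p}$ depends on $n$, $p$ and $\tilde\phi_n$ but not on $f$ or $b-a$. There is a unique monic polynomial $\tilde\phi_n$ of degree $n$ that minimizes $K_{n,p}$, and the minimum value is $\tilde K_{n,p}=2^{-n-1/q}\|\tilde\phi_n\|_q/n!$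 for this polynomial. With this choice of $\tilde\phi_n$ the estimate on $|E_n(f)|$ is sharp, in the sense that the coefficient of $\|f^{(n)}\|_p$ cannot be reduced (i.e. no smaller constant makes the inequality hold for all such $f$).
   Context: $L^p([a,b])$ is the Lebesgue space with norm $\|g\|_p=(\int_a^b|g|^p)^{1/p}$ for $1\le p<\infty$ and $\|g\|_\infty=\operatorname{ess\,sup}|g|$. Conjugate exponents satisfy $1/p+1/q=1$ with the convention $1/\infty=0$. A monic polynomial is one with leading coefficient $1$. *)

(* Defs.v *)
From HB Require Import structures.
From mathcomp Require Import all_boot all_order all_algebra.
From mathcomp Require Import all_classical all_reals all_analysis.
Set Implicit Arguments. Unset Strict Implicit. Unset Printing Implicit Defensive.
Import Order.TTheory GRing.Theory Num.Theory.
Import numFieldNormedType.Exports.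
Local Open Scope classical_set_scope.
Local Open Scope ring_scope.

Section Defs.
Variable R : realType.

Definition inv_exp (p : \bar R) : R :=
  match p with r%:E => r^-1 | _ => 0 end.

Definition conj_exp (p q : \bar R) : Prop :=
  (1 <= p)%E /\ (1 <= q)%E /\ inv_exp p + inv_exp q = 1.

(* L^p([a,b]) norm of g (Lebesgue measure); for p = +oo this is the
   essential supremum of |g| on [a,b]. *)
Definition LpN (p : \bar R) (a b : R) (g : R -> R) : \bar R :=
  Lnorm (@lebesgue_measure R) p ((EFin \o g) \_ [set` `[a, b]]).

Definition abs_cont_on (a b : R) (g : R -> R) : Prop :=
  forall e : R, 0 < e -> exists d : R, 0 < d /\
    forall (m : nat) (s t : nat -> R),
      (forall i, (i < m)%N -> a <= s i /\ s i <= t i /\ t i <= b) ->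
      (forall i j, (i < j)%N -> (j < m)%N -> t i <= s j) ->
      \sum_(i < m) (t i - s i) < d ->
      \sum_(i < m) `|g (t i) - g (s i)| < e.

(* l is the derivative of g at x relative to the set A (one-sided at the
   endpoints when A is an interval) *)
Definition deriv_within (A : set R) (g : R -> R) (x l : R) : Prop :=
  (fun h : R => h^-1 * (g (x + h) - g x)) @
     within [set h | h != 0 /\ A (x + h)] (nbhs (0 : R)) --> l.

(* F k plays the role of f^(k) (k <= n) on [a,b]:
   f^(k+1) is the derivative of f^(k) on [a,b] for k < n-1,
   f^(n-1) is absolutely continuous on [a,b], f^(n) is its a.e. derivative,
   and f^(n) is in L^p([a,b]). *)
Definition admissible (n : nat) (p : \bar R) (a b : R) (F : nat -> R -> R)
  : Prop :=
  [/\ (forall k, (k < n.-1)%N -> forall x, [set` `[a, b]] x ->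
         deriv_within [set` `[a, b]] (F k) x (F k.+1 x)),
      abs_cont_on a b (F n.-1),
      {ae @lebesgue_measure R, forall x, [set` `]a, b[] x ->
         is_derive x (1 : R) (F n.-1) (F n x)},
      measurable_fun [set` `[a, b]] (F n) &
      (LpN p a b (F n) < +oo)%E].

Definition En (n : nat) (a b : R) (F : nat -> R -> R) (phi : {poly R})
  : \bar R :=
  (((-1) ^+ n / (n`!)%:R)%:E *
    \int[@lebesgue_measure R]_(x in `[a, b]) (F n x * phi.[x])%:E)%E.

Definition boundary_part (n : nat) (a b : R) (F : nat -> R -> R)
  (phi : {poly R}) : R :=
  (-1) ^+ n / (n`!)%:R *
  \sum_(k < n) (-1) ^+ (n - k - 1) *
     ((phi^`(n - k - 1)).[a] * F k a - (phi^`(n - k - 1)).[b] * F k b).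

Definition Kconst (n : nat) (q : \bar R) (t : {poly R}) : \bar R :=
  ((2 `^ (- (n%:R) - inv_exp q))%:E * LpN q (-1) 1 (fun x => t.[x]) *
    ((n`!)%:R^-1)%:E)%E.

End Defs.

(* Main.v *)
(* The identity is the fundamental theorem of calculus for the absolutely
   continuous function sum_k (-1)^(n-k-1) phi^(n-k-1) f^(k), whose a.e.
   derivative telescopes to phi f^(n) - (-1)^n n! f.  That theorem is proved by
   a gauge argument: subtract the indefinite integral, cover the null set of bad
   points by an open set of small measure, and run a Cousin-type induction along
   [a, b], charging good points to the small slope and bad points to absolute
   continuity.  The estimate is Hoelder's inequality and the passage to [-1, 1]
   is an affine change of variable.

   A minimizer exists by compactness.  For uniqueness let s, t be minimizers,
   u their midpoint and d = (s - t)/2.  If q < oo, equality in Minkowski forces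
   |s + t| = |s| + |t|, hence |d| <= |u|, so d is a multiple of the product v of
   the factors of u whose roots lie in [a, b]; if deg v < n then u = v w with
   w > 0, and v (w - e) is a better polynomial.  If q = oo and M is the minimal
   norm, |d| + |u| <= M, so |d| <= (M^2 - u^2)/M and the same argument applies to
   the roots of M^2 - u^2, the better polynomial being u - k (u mod v).

   For sharpness one may take f^(n) continuous: sgn(phi)|phi|^(q-1) if
   1 < q < oo, phi/(|phi| + e) if q = 1, and a soft thresholding of phi just
   below its maximum modulus if q = oo. *)
Require Import Defs.
From HB Require Import structures.
From mathcomp Require Import all_boot all_order all_algebra.
From mathcomp Require Import all_classical all_reals all_analysis.
From mathcomp Require Import measurable_realfun ess_sup_inf hoelder.
From mathcomp Require Import ring lra.
Set Implicit Arguments. Unset Strict Implicit. Unset Printing Implicit Defensive.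
Import Order.TTheory GRing.Theory Num.Theory.
Import numFieldNormedType.Exports.
Local Open Scope classical_set_scope.
Local Open Scope ring_scope.

(** * Fundamental theorem of calculus for absolutely continuous functions *)

(** Stands in for a tagged partition: the hypothesis at the supremum [c] of the points where [P]
    holds carries [P] from just left of [c] to beyond it, or to [b]. *)
Lemma cousin_induction (R : realType) (a b : R) (P : R -> Prop) :
  a <= b -> P a ->
  (forall c, a <= c <= b -> exists2 r, 0 < r & forall x y,
     a <= x -> x <= c -> c <= y -> y <= b -> c - r < x -> y < c + r ->
     P x -> P y) ->
  P b.
Proof.
move=> ab Pa step.
pose S := [set x | a <= x <= b /\ P x].
have Sa : S a by split=> //; rewrite lexx.
have Sub : ubound S b by move=> x [/andP[]].
have hS : has_sup S by split; [exists a|exists b].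
pose c := sup S.
have ac : a <= c by apply: sup_upper_bound.
have cb : c <= b by apply: ge_sup => //; exists a.
have [|r r0 stepc] := step c; first by rewrite ac cb.
have [x [/andP[ax xb] Px] cx] := sup_adherent r0 hS.
have xc : x <= c by apply: sup_upper_bound => //; split=> //; rewrite ax xb.
have [cbr|bcr] := ltP b (c + r).
  exact: (stepc x b).
have Py : P (c + r / 2).
  by apply: (stepc x) => //; lra.
have : c + r / 2 <= c.
  by apply: sup_upper_bound => //; split=> //; apply/andP; split; lra.
by lra.
Qed.

(** Lists of intervals suit an induction along [a, b], which appends one interval at a time on the
    right. *)
Lemma abs_cont_on_seq (R : realType) (a b e : R) (g : R -> R) :
  abs_cont_on a b g -> 0 < e ->
  exists2 d, 0 < d & forall l : seq (R * R),
    all (fun u => [&& a <= u.1, u.1 <= u.2 & u.2 <= b]) l ->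
    pairwise (fun u v : R * R => u.2 <= v.1) l ->
    \sum_(u <- l) (u.2 - u.1) < d ->
    \sum_(u <- l) `|g u.2 - g u.1| < e.
Proof.
move=> acg e0; have [d [d0 dP]] := acg e e0; exists d => // l /allP lab lp.
rewrite (big_nth (0, 0)) [X in _ -> X < _](big_nth (0, 0)) !big_mkord.
apply: (dP (size l) (fun i => (nth (0, 0) l i).1)
                    (fun i => (nth (0, 0) l i).2)).
  by move=> i il; have /and3P[] := lab _ (mem_nth (0, 0) il).
move=> i j ij jl; apply: (pairwiseP (0, 0) lp) => //.
by rewrite inE (ltn_trans ij).
Qed.

Lemma EFin_Rintegral (R : realType) (D : set R) (f : R -> R) :
  measurable D -> (@lebesgue_measure R).-integrable D (EFin \o f) ->
  (\int[@lebesgue_measure R]_(x in D) f x)%:E =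
  (\int[@lebesgue_measure R]_(x in D) (f x)%:E)%E.
Proof. by move=> mD fi; rewrite /Rintegral fineK//; exact: integrable_fin_num. Qed.

Section FTC_absolutely_continuous.
Variable R : realType.
Notation mu := (@lebesgue_measure R).
Implicit Types (a b x y : R) (O : set R) (f g h H : R -> R).

Lemma is_derive0_slope g x (e : R) : is_derive x 1 g 0 -> 0 < e ->
  exists2 r, 0 < r & forall y, `|y - x| < r -> `|g y - g x| <= e * `|y - x|.
Proof.
move=> dg e0.
have : h^-1 *: (g (h + x) - g x) @[h --> 0^'] --> (0 : R).
  have [dg1 dg2] := dg.
  have : h^-1 *: ((g \o shift x) (h *: 1) - g x) @[h --> 0^'] --> 'D_1 g x.
    exact: dg1.
  rewrite dg2.
  suff -> : (fun h : R => h^-1 *: ((g \o shift x) (h *: 1) - g x)) =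
    (fun h : R => h^-1 *: (g (h + x) - g x)) by [].
  by apply/funext => h /=; rewrite [h *: 1]mulr1.
move/cvgrPdist_lt => /(_ e e0) [r /= r0 rP].
exists r => // y yx.
have [->|yNx] := eqVneq y x; first by rewrite !subrr normr0 mulr0.
have yx0 : y - x != 0 by rewrite subr_eq0.
have /= := rP (y - x); rewrite /ball_/= !sub0r !normrN subrK => /(_ yx yx0).
rewrite normrM normfV mulrC ltr_pdivrMr ?normr_gt0// => /ltW.
by rewrite mulrC.
Qed.

(** With the next lemma, controls the mass of an open cover [O] up to a moving endpoint: it never
    decreases, and it grows by the full integral over an interval contained in [O]. *)
Lemma Rintegral_setI_itv_incr O h (a x y : R) :
  open O -> mu.-integrable setT (EFin \o h) -> a <= x -> x <= y ->
  \int[mu]_(t in O `&` `[a, x]) `|h t| <= \int[mu]_(t in O `&` `[a, y]) `|h t|.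
Proof.
move=> oO ih ax xy.
have mO : measurable O by exact: open_measurable.
have ihA (A : set R) : measurable A -> mu.-integrable A (EFin \o (fun t => `|h t|)).
  move=> mA; apply: (@integrableS _ _ _ _ setT) => //.
  exact: (integrable_abse ih).
have -> : O `&` `[a, y] = (O `&` `[a, x]) `|` (O `&` `]x, y]).
  rewrite -setIUr; congr (_ `&` _).
  by rewrite -itv_bndbnd_setU// bnd_simp.
rewrite Rintegral_setU//=.
- by rewrite lerDl; apply: Rintegral_ge0.
- exact: measurableI.
- exact: measurableI.
- by apply: ihA; apply: measurableU; exact: measurableI.
- apply/disj_set2P; rewrite -subset0 => z/= [[_ +] [_]].
  by rewrite !in_itv/= => /andP[_ zx] /andP[xz _]; have := lt_le_trans xz zx; rewrite ltxx.
Qed.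

Lemma Rintegral_setI_itvD O h (a x y : R) :
  open O -> mu.-integrable setT (EFin \o h) -> a <= x -> x <= y ->
  `[x, y] `<=` O ->
  \int[mu]_(t in O `&` `[a, y]) `|h t| =
  \int[mu]_(t in O `&` `[a, x]) `|h t| + \int[mu]_(t in `]x, y]) `|h t|.
Proof.
move=> oO ih ax xy xyO.
have mO : measurable O by exact: open_measurable.
have ihA (A : set R) : measurable A -> mu.-integrable A (EFin \o (fun t => `|h t|)).
  move=> mA; apply: (@integrableS _ _ _ _ setT) => //.
  exact: (integrable_abse ih).
have -> : O `&` `[a, y] = (O `&` `[a, x]) `|` `]x, y].
  rewrite (itv_bndbnd_setU (x := BRight x)) ?bnd_simp// setIUr; congr (_ `|` _).
  apply/setIidr; apply: subset_trans xyO; exact: subset_itv_oc_cc.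
rewrite Rintegral_setU//=.
- exact: measurableI.
- by apply: ihA; apply: measurableU => //; exact: measurableI.
- apply/disj_set2P; rewrite -subset0 => z/= [[_ +]].
  by rewrite !in_itv/= => /andP[_ zx] /andP[xz _]; have := lt_le_trans xz zx; rewrite ltxx.
Qed.

Lemma null_set_open_cover (N : set R) (d : R) : measurable N -> mu N = 0%E ->
  0 < d -> exists O, [/\ open O, N `<=` O & (mu O < d%:E)%E].
Proof.
move=> mN N0 d0.
have [|O [oO NO Od]] := lebesgue_regularity_outer mN _ d0.
  by rewrite [ltLHS]N0.
exists O; split => //; apply: le_lt_trans Od.
have mO : measurable O by exact: open_measurable.
rewrite -(setDUK NO); apply: (le_trans (measureU2 _ _ _)) => //.
  exact: measurableD.
by rewrite [X in (X + _)%E]N0 add0e setDUK.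
Qed.

Lemma abs_cont_FTC (a b : R) H h : a < b -> abs_cont_on a b H ->
  mu.-integrable `[a, b] (EFin \o h) ->
  {ae mu, forall x, `]a, b[%classic x -> is_derive x (1 : R) H (h x)} ->
  (\int[mu]_(x in `[a, b]) (h x)%:E = (H b - H a)%:E)%E.
Proof.
move=> ab acH ih dH.
(* Extension by zero makes the integrand integrable on the whole line, as the a.e. differentiation
   theorem for [J] asks. *)
pose f := h \_ `[a, b].
have iff : mu.-integrable setT (EFin \o f).
  by rewrite -restrict_EFin; apply/integrable_restrict => //=; rewrite setTI.
have iffA (A : set R) : measurable A -> mu.-integrable A (EFin \o f).
  by move=> mA; apply: (@integrableS _ _ _ _ setT).
pose J x := \int[mu]_(t in `[a, x]) f t.
have dJ : {ae mu, forall x, a < x -> derivable J x 1 /\ derive1 J x = f x}.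
  have := @FTC1 R f (BLeft a).
  apply => //; first by move=> y; apply: iffA.
  exact: integrable_locally.
have -> : (\int[mu]_(x in `[a, b]) (h x)%:E = (J b)%:E)%E.
  rewrite /J EFin_Rintegral//; last exact: iffA.
  by apply: eq_integral => x xab; rewrite /f patchE xab.
congr EFin.
have Ja : J a = 0 by rewrite /J set_itv1 Rintegral_set1.
pose G x := H x - J x.
suff : G b = G a by rewrite /G Ja; clear; lra.
have dG : {ae mu, forall x, `]a, b[%classic x -> is_derive x (1 : R) G 0}.
  apply: (filterS2 (ae_filter_ringOfSetsType mu)) dH dJ => x dHx dJx xab.
  have [ax xb] : a < x /\ x < b by move: xab; rewrite /= in_itv/= => /andP[].
  have [Jx1 Jx2] := dJx ax.
  have Hx := dHx xab.
  have Jx : is_derive x (1 : R) J (h x).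
    apply: DeriveDef => //; rewrite -derive1E Jx2 /f patchE mem_set//=.
    by rewrite in_itv/= !ltW.
  have : is_derive x (1 : R) (H - J) (h x - h x) by apply: is_deriveB.
  by rewrite subrr.
have [N [mN N0 Nsub]] := dG.
apply/eqP; rewrite -subr_eq0 -normr_le0; apply/ler_addgt0Pr => e0 e0p.
rewrite add0r.
(* The total error is [e (b - a)] from good points, [e] from the variation of [H] over bad
   intervals, and [e] from the integral of |f| over [O]. *)
pose e := e0 / (b - a + 2).
have ba0 : 0 < b - a by rewrite subr_gt0.
have e_gt0 : 0 < e by rewrite divr_gt0// addr_gt0.
have -> : e0 = e * (b - a) + e + e.
  by rewrite /e; field; lra.
have [d d0 dP] := abs_cont_on_seq acH e_gt0.
have [d' [d'0 d'P]] := integral_normr_continuous iff e_gt0.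
(* The derivative is known only in the open interval, so the endpoints count as bad points. *)
pose N' := N `|` ([set a] `|` [set b]).
have mN' : measurable N' by apply: measurableU => //; apply: measurableU.
have N'0 : mu N' = 0%E.
  rewrite measureU0//; first exact: measurableU.
  rewrite measureU0//; exact: lebesgue_measure_set1.
have [|O [oO NO Od]] := @null_set_open_cover N' (Num.min d d') mN' N'0.
  by rewrite lt_min d0.
have mO : measurable O by exact: open_measurable.
have muI x : (mu (O `&` `[a, x]) <= mu O)%E.
  by apply: le_measure; rewrite ?inE//; exact: measurableI.
(* An indicator function, so that [M x] is the measure of the part of [O] in [a, x] and obeys the
   same two lemmas as [K]. *)
pose u := (cst 1 : R -> R) \_ `[a, b].
have iu : mu.-integrable setT (EFin \o u).
  rewrite -restrict_EFin; apply/integrable_restrict => //=; rewrite setTI.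
  apply: continuous_compact_integrable; first exact: segment_compact.
  by apply: continuous_subspaceT => x; exact: cvg_cst.
pose M x := \int[mu]_(t in O `&` `[a, x]) `|u t|.
pose K x := \int[mu]_(t in O `&` `[a, x]) `|f t|.
(* The invariant: [l] lists the bad intervals met so far, [M] bounds their total length, and the
   change of [G] is split into the three kinds of error. *)
pose P x := exists l : seq (R * R),
  [/\ all (fun v => [&& a <= v.1, v.1 <= v.2 & v.2 <= x]) l,
      pairwise (fun v w : R * R => v.2 <= w.1) l,
      \sum_(v <- l) (v.2 - v.1) <= M x &
      `|G x - G a| <= e * (x - a) + \sum_(v <- l) `|H v.2 - H v.1| + K x].
have [||l [l1 l2 l3 l4]] := @cousin_induction R a b P (ltW ab).
- exists [::]; split; rewrite ?big_nil//; first by apply: Rintegral_ge0.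
  by rewrite !subrr normr0 mulr0 !add0r; apply: Rintegral_ge0.
- move=> c /andP[ac cb].
  (* If [c] is in [O], the interval [x, y] joins the list; the growth of [M] pays for its length and
     that of [K] for the change of [J]. *)
  have [cO|cNO] := pselect (O c).
    have [r/= r0 rO] : exists2 r : R, 0 < r & ball c r `<=` O.
      by have := open_nbhs_nbhs (conj oO cO) => /nbhs_ballP.
    exists r => // x y ax xc cy yb crx ycr [l [l1 l2 l3 l4]].
    have xyO : `[x, y] `<=` O.
      move=> z/=; rewrite in_itv/= => /andP[xz zy]; apply: rO.
      by rewrite /ball/= ltr_distlC (lt_le_trans crx xz) (le_lt_trans zy ycr).
    have xy : x <= y by exact: le_trans xc cy.
    exists (rcons l (x, y)); split.
    + rewrite all_rcons/= ax xy lexx/=; apply: sub_all l1 => v /and3P[-> ->/=].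
      by move=> /le_trans; apply.
    + rewrite pairwise_rcons l2 andbT; apply: sub_all l1 => v /and3P[_ _ ->]//.
    + rewrite -cats1 big_cat big_seq1/= /M (@Rintegral_setI_itvD _ _ a x y)//.
      apply: lerD => //.
      have -> : \int[mu]_(t in `]x, y]) `|u t| = \int[mu]_(t in `]x, y]) (cst 1) t.
        apply: eq_Rintegral => t; rewrite inE/= in_itv/= => /andP[xt ty].
        rewrite /u patchE mem_set ?normr1//= in_itv/=.
        by rewrite (le_trans ax (ltW xt)) (le_trans ty yb).
      rewrite Rintegral_cst//= mul1r lebesgue_measure_itv/= lte_fin.
      by case: ltP => //= yx; rewrite subr_le0.
    + rewrite -cats1 big_cat big_seq1/= /K (@Rintegral_setI_itvD _ _ a x y)//.
      have JJ : `|J y - J x| <= \int[mu]_(t in `]x, y]) `|f t|.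
        rewrite /J Rintegral_itvB//; last exact: iffA.
        by apply: le_normr_Rintegral => //; exact: iffA.
      have -> : G y - G a = (G x - G a) + ((H y - H x) - (J y - J x)).
        by rewrite /G; ring.
      have := ler_normD (G x - G a) ((H y - H x) - (J y - J x)).
      have := ler_normB (H y - H x) (J y - J x).
      have : e * (x - a) <= e * (y - a) by rewrite ler_pM2l// lerD2r.
      by move: l4 JJ; rewrite /K; clear; lra.
  (* Off [O], [c] is interior and [G] has derivative 0 there; comparing [x] and [y] with [c] costs
     at most [e (y - x)], and the list is kept. *)
  have [/eqP ca|ca] := boolP (c == a); first by case: cNO; apply: NO; right; left.
  have [/eqP cb'|cb'] := boolP (c == b); first by case: cNO; apply: NO; right; right.
  have dGc : is_derive c (1 : R) G 0.
    apply: contrapT => nd; case: cNO; apply: NO; left; apply: Nsub => /= /(_ _).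
    move=> nP; apply: nd; apply: nP; rewrite /= in_itv/=.
    by rewrite !lt_neqAle eq_sym ca ac cb' cb.
  have [r r0 rP] := is_derive0_slope dGc e_gt0.
  exists r => // x y ax xc cy yb crx ycr [l [l1 l2 l3 l4]].
  exists l; split => //.
  + apply: sub_all l1 => v /and3P[-> ->/=] vx; exact: le_trans vx (le_trans xc cy).
  + apply: (le_trans l3); apply: Rintegral_setI_itv_incr => //; exact: le_trans xc cy.
  + have : K x <= K y by apply: Rintegral_setI_itv_incr => //; exact: le_trans xc cy.
    have Hy : `|G y - G c| <= e * (y - c).
      by have := rP y; rewrite ger0_norm ?subr_ge0//; apply; rewrite ltrBlDl.
    have Hx : `|G x - G c| <= e * (c - x).
      have := rP x; rewrite ler0_norm ?subr_le0// opprB; apply.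
      by rewrite ltrBlDl -ltrBlDr.
    have -> : G y - G a = (G x - G a) + ((G y - G c) - (G x - G c)) by ring.
    have := ler_normD (G x - G a) ((G y - G c) - (G x - G c)).
    have := ler_normB (G y - G c) (G x - G c).
    by move: l4 Hy Hx; clear; lra.
have Odd' : (mu O < d%:E)%E /\ (mu O < d'%:E)%E.
  by split; apply: (lt_le_trans Od); rewrite lee_fin ge_min lexx ?orbT.
have Mb : M b < d.
  have -> : M b = \int[mu]_(t in O `&` `[a, b]) (cst 1) t.
    apply: eq_Rintegral => t; rewrite inE => -[_ tab].
    by rewrite /u patchE mem_set ?normr1.
  rewrite Rintegral_cst//=; last exact: measurableI.
  rewrite mul1r -lte_fin fineK; first exact: le_lt_trans (muI b) Odd'.1.
  rewrite ge0_fin_numE//; apply: le_lt_trans (muI b) _.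
  exact: lt_trans Odd'.1 (ltry _).
have Kb : K b < e.
  by apply: d'P; [exact: measurableI|exact: le_lt_trans (muI b) Odd'.2].
(* The listed intervals have total length below [d], so absolute continuity bounds the variation of
   [H] over them by [e]. *)
have := dP l l1 l2 (le_lt_trans l3 Mb).
by move: l4 Kb; clear; lra.
Qed.

End FTC_absolutely_continuous.

(** * Absolutely continuous functions and one-sided derivatives *)

Section absolute_continuity.
Variable R : realType.
Implicit Types (a b x y l : R) (f g : R -> R).

Lemma abs_cont_on_dist a b g (e : R) : abs_cont_on a b g -> 0 < e ->
  exists2 d, 0 < d & forall x y, a <= x <= b -> a <= y <= b ->
    `|y - x| < d -> `|g y - g x| < e.
Proof.
move=> acg e0; have [d d0 dP] := abs_cont_on_seq acg e0.
exists d => // x y.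
wlog xy : x y / x <= y => [hw ax ay|].
  have [xy|yx] := leP x y; first exact: hw.
  by rewrite distrC (distrC (g y)); apply: hw => //; exact: ltW.
move=> /andP[ax xb] /andP[ay yb]; rewrite ger0_norm ?subr_ge0// => yxd.
have := dP [:: (x, y)]; rewrite !big_seq1/= ax xy yb; exact.
Qed.

Lemma abs_cont_on_continuous a b g : abs_cont_on a b g ->
  {within `[a, b], continuous g}.
Proof.
move=> acg; apply/subspace_continuousP => x /= xab.
apply/cvgrPdist_lt => e e0; have [d d0 dP] := abs_cont_on_dist acg e0.
near=> y; rewrite distrC; apply: dP.
- by move: xab; rewrite in_itv.
- suff : y \in `[a, b] by rewrite in_itv.
  by near: y; apply: withinT.
- rewrite distrC; near: y; apply: cvg_within; exact: (nbhsx_ballx x d d0).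
Unshelve. all: by end_near. Qed.

Lemma continuous_itv_bounded a b g : a <= b -> {within `[a, b], continuous g} ->
  exists2 M, 0 < M & forall x, a <= x <= b -> `|g x| <= M.
Proof.
move=> ab cg.
have cn : {within `[a, b], continuous (fun x => `|g x|)}.
  by move=> x; apply: cvg_norm; exact: cg.
have [c _ cM] := EVT_max ab cn.
exists (`|g c| + 1) => [|x xab]; first by rewrite ltr_wpDl.
by apply: (le_trans (cM x _)); rewrite ?in_itv// lerDl.
Qed.

Lemma lipschitz_abs_cont_on a b g (M : R) :
  (forall x y, a <= x -> x <= y -> y <= b -> `|g y - g x| <= M * (y - x)) ->
  abs_cont_on a b g.
Proof.
move=> gM e e0; pose M' := `|M| + 1.
have M'0 : 0 < M' by rewrite ltr_wpDl.
exists (e / M'); split; first exact: divr_gt0.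
move=> m s t st _ sume.
apply: (@le_lt_trans _ _ (\sum_(i < m) M' * (t i - s i))).
  apply: ler_sum => i _; have [ai [sti tb]] := st i (ltn_ord i).
  apply: le_trans (gM _ _ ai sti tb) _; rewrite ler_wpM2r ?subr_ge0//.
  by rewrite (le_trans (ler_norm _))// lerDl.
by rewrite -mulr_sumr mulrC -ltr_pdivlMr.
Qed.

Lemma abs_cont_onD a b f g : abs_cont_on a b f -> abs_cont_on a b g ->
  abs_cont_on a b (fun x => f x + g x).
Proof.
move=> acf acg e e0; have e20 : 0 < e / 2 by rewrite divr_gt0.
have [d [d0 dP]] := acf _ e20; have [d' [d'0 d'P]] := acg _ e20.
exists (Num.min d d'); rewrite lt_min d0; split => // m s t st ts sume.
have /andP[sumd sumd'] : (\sum_(i < m) (t i - s i) < d) &&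
    (\sum_(i < m) (t i - s i) < d') by rewrite -lt_min.
have := dP m s t st ts sumd; have := d'P m s t st ts sumd'.
suff : \sum_(i < m) `|f (t i) + g (t i) - (f (s i) + g (s i))| <=
  \sum_(i < m) `|f (t i) - f (s i)| + \sum_(i < m) `|g (t i) - g (s i)| by lra.
rewrite -big_split/=; apply: ler_sum => i _.
rewrite (_ : _ - _ = (f (t i) - f (s i)) + (g (t i) - g (s i))); last by ring.
exact: ler_normD.
Qed.

Lemma abs_cont_onM a b f g : a <= b -> abs_cont_on a b f -> abs_cont_on a b g ->
  abs_cont_on a b (fun x => f x * g x).
Proof.
move=> ab acf acg e e0.
have [M M0 fM] := continuous_itv_bounded ab (abs_cont_on_continuous acf).
have [M' M'0 gM'] := continuous_itv_bounded ab (abs_cont_on_continuous acg).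
have e10 : 0 < e / 2 / M' by rewrite !divr_gt0.
have e20 : 0 < e / 2 / M by rewrite !divr_gt0.
have [d [d0 dP]] := acf _ e10; have [d' [d'0 d'P]] := acg _ e20.
exists (Num.min d d'); rewrite lt_min d0; split => // m s t st ts sume.
have /andP[sumd sumd'] : (\sum_(i < m) (t i - s i) < d) &&
    (\sum_(i < m) (t i - s i) < d') by rewrite -lt_min.
have := dP m s t st ts sumd; have := d'P m s t st ts sumd'.
rewrite !ltr_pdivlMr// => sg sf.
suff : \sum_(i < m) `|f (t i) * g (t i) - f (s i) * g (s i)| <=
  \sum_(i < m) `|f (t i) - f (s i)| * M' + \sum_(i < m) `|g (t i) - g (s i)| * M.
  by rewrite -!mulr_suml; lra.
rewrite -big_split/=; apply: ler_sum => i _.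
have [ai [sti tb]] := st i (ltn_ord i).
rewrite (_ : _ - _ = (f (t i) - f (s i)) * g (t i) + (g (t i) - g (s i)) * f (s i)); last by ring.
rewrite (le_trans (ler_normD _ _))// !normrM.
apply: lerD; rewrite ler_wpM2l//.
  by apply: gM'; rewrite tb (le_trans ai).
by apply: fM; rewrite ai (le_trans sti).
Qed.

Lemma abs_cont_on_sum a b (n : nat) (f : nat -> R -> R) :
  (forall k, (k < n)%N -> abs_cont_on a b (f k)) ->
  abs_cont_on a b (fun x => \sum_(k < n) f k x).
Proof.
elim: n => [_|n IH fn].
  apply: (@lipschitz_abs_cont_on _ _ _ 0) => x y _ _ _.
  by rewrite !big_ord0 subrr normr0 mul0r.
rewrite (_ : (fun x => _) = (fun x => \sum_(k < n) f k x + f n x)); last first.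
  by apply/funext => x; rewrite big_ord_recr.
by apply: abs_cont_onD; [apply: IH => k kn; apply: fn; exact: ltnW|exact: fn].
Qed.

(** A continuous derivative is bounded on [a, b], so the mean value theorem makes [f] Lipschitz. *)
Lemma derivable_abs_cont_on a b f (df : R -> R) : a <= b ->
  {within `[a, b], continuous f} ->
  (forall x, a < x < b -> is_derive x 1 f (df x)) ->
  {within `[a, b], continuous df} ->
  abs_cont_on a b f.
Proof.
move=> ab cf fd cdf.
have [M M0 fM] := continuous_itv_bounded ab cdf.
apply: (@lipschitz_abs_cont_on _ _ _ M) => x y ax xy yb.
have [z /[!in_itv]/= zxy| |z zxy ->] := @MVT_segment _ f df x y xy.
- by apply: fd; move: zxy; lra.
- apply: continuous_subspaceW cf => z /=.
  by rewrite !in_itv/= => /andP[xz zy]; rewrite (le_trans ax)//= (le_trans zy).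
rewrite normrM (ger0_norm (_ : 0 <= y - x)) ?subr_ge0// ler_wpM2r ?subr_ge0//.
by apply: fM; move: zxy; rewrite in_itv/=; lra.
Qed.



Lemma horner_abs_cont_on a b (p : {poly R}) : a <= b -> abs_cont_on a b (fun x => p.[x]).
Proof.
move=> ab; apply: (derivable_abs_cont_on ab (df := fun x => p^`().[x])).
- by apply: continuous_subspaceT => x; exact: continuous_horner.
- by move=> x _; exact: is_derive_poly.
- by apply: continuous_subspaceT => x; exact: continuous_horner.
Qed.

(** Near [x] the difference quotient is below [|l| + 1] in absolute value, hence |g y - g x| is at
    most (|l| + 1) |y - x| for [y] in [A]. *)
Lemma deriv_within_cvg (A : set R) g x l : deriv_within A g x l ->
  g y @[y --> within A (nbhs x)] --> g x.
Proof.
move=> /cvgrPdist_lt /(_ 1 ltr01) /nbhs_ballP[r/= r0 rP].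
apply/cvgrPdist_lt => e e0.
have l0 : 0 < `|l| + 1 by rewrite ltr_wpDl.
have er0 : 0 < Num.min r (e / (`|l| + 1)) by rewrite lt_min r0 divr_gt0.
apply/nbhs_ballP; exists (Num.min r (e / (`|l| + 1))) => // y/=.
rewrite /ball/= distrC lt_min => /andP[yr ye] Ay.
have [->|yx] := eqVneq y x; first by rewrite subrr normr0.
have yx0 : 0 < `|y - x| by rewrite normr_gt0 subr_eq0.
have /= := rP (y - x); rewrite /ball/= sub0r normrN [x + _]addrC subrK => /(_ yr).
rewrite subr_eq0 yx => /(_ (conj isT Ay)).
move=> h1; have h2 : `|(y - x)^-1 * (g y - g x)| < `|l| + 1.
  rewrite -(subrK l (_ * _)) (le_lt_trans (ler_normD _ _))// addrC ltrD2l.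
  by rewrite distrC.
move: h2; rewrite normrM normfV mulrC ltr_pdivrMr// => h2.
rewrite distrC (lt_le_trans h2)// mulrC -ler_pdivlMr//; exact: ltW.
Qed.

(** At an interior point small increments stay in [a, b], so the restricted limit is the ordinary
    one. *)
Lemma deriv_within_is_derive a b g x l : a < x < b ->
  deriv_within `[a, b] g x l -> is_derive x (1 : R) g l.
Proof.
move=> /andP[ax xb] dg.
have H : h^-1 *: ((g \o shift x) (h *: 1) - g x) @[h --> 0^'] --> l.
  move: dg => /cvgrPdist_lt dg; apply/cvgrPdist_lt => e e0.
  have /nbhs_ballP[r/= r0 rP] := dg e e0.
  have d0 : 0 < Num.min r (Num.min (x - a) (b - x)) by rewrite !lt_min r0 !subr_gt0 ax.
  exists (Num.min r (Num.min (x - a) (b - x))) => // h/=.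
  rewrite sub0r normrN !lt_min => /and3P[hr ha hb] h0.
  have := rP h; rewrite /ball/= sub0r normrN [h *: 1]mulr1 [h + x]addrC.
  apply => //; split => //=; rewrite in_itv/=.
  by move: ha hb; rewrite !ltr_norml; lra.
apply: DeriveDef; first by apply/cvg_ex; exists l.
by apply/cvg_lim.
Qed.

Lemma is_derive_deriv_within (A : set R) g x l : is_derive x (1 : R) g l ->
  deriv_within A g x l.
Proof.
move=> [dg1 dg2].
have : h^-1 *: ((g \o shift x) (h *: 1) - g x) @[h --> 0^'] --> l.
  by rewrite -dg2; exact: dg1.
move=> /cvgrPdist_lt dg; apply/cvgrPdist_lt => e e0.
have [r/= r0 rP] := dg e e0.
apply/nbhs_ballP; exists r => // h hr [h0 _].
have := rP h hr h0; rewrite /= [h *: 1]mulr1 [h + x]addrC; exact.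
Qed.

End absolute_continuity.

(** * Repeated integration by parts *)

Section quadrature_identity.
Variable R : realType.
Notation mu := (@lebesgue_measure R).

Lemma derivn_monic (n : nat) (phi : {poly R}) : phi \is monic ->
  size phi = n.+1 -> phi^`(n) = (n`!)%:R%:P.
Proof.
move=> mphi sphi; apply/polyP => i; rewrite coef_derivn coefC.
case: i => [|i] /=.
  rewrite addn0 ffactnn; move: mphi; rewrite monicE lead_coefE sphi => /eqP ->.
  by [].
by rewrite nth_default ?mul0rn// sphi addnS ltnS leq_addr.
Qed.

Lemma is_derive_sumr (x : R) (n : nat) (f : nat -> R -> R) (df : nat -> R) :
  (forall k, (k < n)%N -> is_derive x (1 : R) (f k) (df k)) ->
  is_derive x (1 : R) (fun y => \sum_(k < n) f k y) (\sum_(k < n) df k).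
Proof.
elim: n => [_|n IH fn].
  rewrite big_ord0 (_ : (fun y => _) = cst 0); first exact: is_derive_cst.
  by apply/funext => y; rewrite big_ord0.
rewrite big_ord_recr/= (_ : (fun y => _) = (fun y => \sum_(k < n) f k y) + f n).
  apply: is_deriveD; last exact: fn.
  by apply: IH => k kn; apply: fn; exact: ltnW.
by apply/funext => y; rewrite big_ord_recr.
Qed.

Variables (n : nat) (a b : R) (F : nat -> R -> R) (phi : {poly R}).
Hypotheses (n0 : (0 < n)%N) (ab : a < b).
Hypothesis dF : forall k, (k < n.-1)%N -> forall x, [set` `[a, b]] x ->
  deriv_within [set` `[a, b]] (F k) x (F k.+1 x).
Hypothesis acF : abs_cont_on a b (F n.-1).
Hypothesis aeF : {ae mu, forall x, [set` `]a, b[] x ->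
  is_derive x (1 : R) (F n.-1) (F n x)}.

Lemma derivative_continuous k : (k < n)%N -> {within `[a, b], continuous (F k)}.
Proof.
move=> kn; have [kn1|kn1] := ltnP k n.-1.
  apply/subspace_continuousP => x xab; apply: deriv_within_cvg; exact: dF.
have -> : k = n.-1 by apply/eqP; rewrite eqn_leq kn1 -ltnS prednK// kn.
exact: abs_cont_on_continuous.
Qed.

(** Below order n - 1 the next derivative exists on all of [a, b] and is continuous; order n - 1 is
    the hypothesis itself. *)
Lemma derivative_abs_cont_on k : (k < n)%N -> abs_cont_on a b (F k).
Proof.
move=> kn; have [kn1|kn1] := ltnP k n.-1; last first.
  by have -> : k = n.-1 by apply/eqP; rewrite eqn_leq kn1 -ltnS prednK// kn.
apply: (derivable_abs_cont_on (ltW ab) _ (df := F k.+1)).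
- exact: derivative_continuous.
- move=> x xab; apply: (deriv_within_is_derive xab); apply: dF => //=.
  by rewrite in_itv/=; move: xab => /andP[/ltW -> /ltW ->].
- by apply: derivative_continuous; rewrite -(prednK n0) ltnS.
Qed.

Let H (x : R) : R :=
  \sum_(k < n) (-1) ^+ (n - k - 1) * ((phi^`(n - k - 1)).[x] * F k x).

Let abs_cont_on_H : abs_cont_on a b H.
Proof.
apply: (abs_cont_on_sum
  (f := fun k x => (-1) ^+ (n - k - 1) * ((phi^`(n - k - 1)).[x] * F k x))) => k kn.
apply: (abs_cont_onM (ltW ab)).
  by apply: (@lipschitz_abs_cont_on _ _ _ _ 0) => x y _ _ _; rewrite subrr normr0 mul0r.
apply: (abs_cont_onM (ltW ab)); last exact: derivative_abs_cont_on.
exact: horner_abs_cont_on (ltW ab).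
Qed.

Hypotheses (mphi : phi \is monic) (sphi : size phi = n.+1).

Let is_derive_H (x : R) : `]a, b[%classic x -> is_derive x (1 : R) (F n.-1) (F n x) ->
  is_derive x (1 : R) H (F n x * phi.[x] - (-1) ^+ n * (n`!)%:R * F 0 x).
Proof.
move=> xab dFn.
have dFk k : (k < n)%N -> is_derive x (1 : R) (F k) (F k.+1 x).
  move=> kn; have [kn1|kn1] := ltnP k n.-1.
    apply: (@deriv_within_is_derive _ a b); first by move: xab; rewrite /= in_itv.
    by apply: dF => //; apply: subset_itv_oo_cc xab.
  have -> : k = n.-1 by apply/eqP; rewrite eqn_leq kn1 -ltnS prednK// kn.
  by rewrite prednK.
(* By the product rule the summand of index [k] in [H] has derivative [c k.+1 - c k]. The end terms
   are [c n], equal to [phi] times [F n], and [c 0], where the n-th derivative of the monic [phi] is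
   n!. *)
pose c k := (-1) ^+ (n - k) * ((phi^`(n - k)).[x] * F k x).
have -> : F n x * phi.[x] - (-1) ^+ n * (n`!)%:R * F 0 x = \sum_(k < n) (c k.+1 - c k).
  rewrite -(big_mkord xpredT (fun k => c k.+1 - c k)) telescope_sumr//.
  by rewrite /c subnn subn0 expr0 derivn0 (derivn_monic mphi sphi) hornerC; ring.
apply: (is_derive_sumr (df := fun k => c k.+1 - c k)
  (f := fun k x => (-1) ^+ (n - k - 1) * ((phi^`(n - k - 1)).[x] * F k x))) => k kn.
have [m nkm] : exists m, (n - k = m.+1)%N.
  by exists (n - k).-1; rewrite prednK// subn_gt0.
have nkSm : (n - k.+1 = m)%N by rewrite subnS nkm.
rewrite /c nkSm nkm subn1/=.
have -> : (-1) ^+ m * (phi^`(m).[x] * F k.+1 x) -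
    (-1) ^+ m.+1 * (phi^`(m.+1).[x] * F k x) =
    (-1) ^+ m * (phi^`(m).[x] * F k.+1 x + F k x * phi^`(m)^`().[x]).
  by rewrite -derivnS exprS; ring.
exact: (is_deriveZ ((-1) ^+ m) (is_deriveM (is_derive_poly phi^`(m) x) (dFk k kn))).
Qed.

Lemma derivative0_integrable : mu.-integrable `[a, b] (EFin \o F 0%N).
Proof.
apply: continuous_compact_integrable; first exact: segment_compact.
exact: derivative_continuous.
Qed.

Lemma Rintegral_by_parts_iter :
  mu.-integrable `[a, b] (EFin \o (fun x => F n x * phi.[x])) ->
  \int[mu]_(x in `[a, b]) (F n x * phi.[x])
    - (-1) ^+ n * (n`!)%:R * \int[mu]_(x in `[a, b]) F 0 x = H b - H a.
Proof.
move=> iFn; have iF0 := derivative0_integrable.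
have iF0' : mu.-integrable `[a, b] (EFin \o (fun x => (-1) ^+ n * (n`!)%:R * F 0 x)).
  exact: (integrableZl _ ((-1) ^+ n * (n`!)%:R) iF0).
have iH : mu.-integrable `[a, b]
    (EFin \o (fun x => F n x * phi.[x] - (-1) ^+ n * (n`!)%:R * F 0 x)).
  exact: (integrableB _ iFn iF0').
rewrite -RintegralZl// -RintegralB//.
apply: EFin_inj; rewrite EFin_Rintegral//.
apply: (abs_cont_FTC ab abs_cont_on_H iH).
move: aeF; apply: filterS; first exact: (ae_filter_ringOfSetsType mu).
by move=> x dFn xab; exact: is_derive_H (dFn xab).
Qed.

Lemma quadrature_identity :
  mu.-integrable `[a, b] (EFin \o (fun x => F n x * phi.[x])) ->
  (\int[mu]_(x in [set` `[a, b]]) (F 0%N x)%:E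
            = (boundary_part n a b F phi)%:E + En n a b F phi)%E.
Proof.
move=> iFn; have iF0 := derivative0_integrable.
rewrite -EFin_Rintegral// /En -EFin_Rintegral//.
have := Rintegral_by_parts_iter iFn.
set I := \int[mu]_(x in _) _; set I0 := \int[mu]_(x in _) _ => E.
rewrite -EFinM -EFinD; congr EFin.
have -> : boundary_part n a b F phi = (-1) ^+ n / (n`!)%:R * (H a - H b).
  rewrite /boundary_part /H -sumrB; congr (_ * _).
  by apply: eq_bigr => k _; rewrite mulrBr.
have -> : H a - H b = (-1) ^+ n * (n`!)%:R * I0 - I by rewrite -opprB -E opprB.
have fn0 : (n`!)%:R != 0 :> R by rewrite pnatr_eq0 -lt0n fact_gt0.
(* This cancels the sign in front of [I0] against the sign of the prefactor. *)
have s2 : (-1) ^+ n * (-1) ^+ n = 1 :> R by rewrite -expr2 sqrr_sign.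
rewrite -mulrDr subrK -[LHS]mul1r -{1}s2.
move: s2; move: ((-1) ^+ n) => s _.
by field.
Qed.

End quadrature_identity.

(** * Polynomials on an interval *)

Section polynomials_on_an_interval.
Variables (R : realType) (a b : R).
Hypothesis ab : a < b.

(** Positivity spreads to the right of [z], or to its left when [z = b]. The nondegenerate interval
    obtained has positive measure, which turns pointwise facts into integral or a.e. ones. *)
Lemma continuous_gt0_subitv (f : R -> R) (z : R) : continuous f -> a <= z <= b ->
  0 < f z -> exists c d, [/\ a <= c, c < d, d <= b &
    forall x, c <= x <= d -> 0 < f x].
Proof.
move=> cf /andP[az zb] fz0.
have /cvgrPdist_lt /(_ _ fz0) /nbhs_ballP[r /= r0 rP] := cf z.
have fP x : `|z - x| < r -> 0 < f x.
  by move=> zx; have := rP x zx; rewrite ltr_norml; lra.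
have [zb'|bz] := ltP z b.
  have m0 : 0 < Num.min (r / 2) (b - z) by rewrite lt_min divr_gt0//= subr_gt0.
  have m1 : Num.min (r / 2) (b - z) <= r / 2 by rewrite ge_min lexx.
  have m2 : Num.min (r / 2) (b - z) <= b - z by rewrite ge_min lexx orbT.
  exists z, (z + Num.min (r / 2) (b - z)); split; [lra..|move=> x xz].
  by apply: fP; rewrite ler0_norm; lra.
have m0 : 0 < Num.min (r / 2) (b - a) by rewrite lt_min divr_gt0//= subr_gt0.
have m1 : Num.min (r / 2) (b - a) <= r / 2 by rewrite ge_min lexx.
have m2 : Num.min (r / 2) (b - a) <= b - a by rewrite ge_min lexx orbT.
exists (b - Num.min (r / 2) (b - a)), b; split; [lra..|move=> x xz].
by apply: fP; rewrite ger0_norm; lra.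
Qed.

(** Positivity at [z] would spread to an interval, one of whose two ends differs from [z]. *)
Lemma continuous_le_except (f : R -> R) (z : R) : continuous f -> a <= z <= b ->
  (forall x, a <= x <= b -> x != z -> f x <= 0) -> f z <= 0.
Proof.
move=> cf zab fle; rewrite leNgt; apply/negP => fz0.
have [c [d [ac cd db cdP]]] := continuous_gt0_subitv cf zab fz0.
have [cz|cz] := eqVneq c z.
  have dz : d != z by rewrite -cz gt_eqF.
  by have := fle d _ dz; have := cdP d; lra.
by have := fle c _ cz; have := cdP c; lra.
Qed.

Lemma horner_const_sign (p : {poly R}) :
  (forall x, a <= x <= b -> p.[x] != 0) -> 0 < p.[a] ->
  forall x, a <= x <= b -> 0 < p.[x].
Proof.
move=> pN0 pa0 x /andP[ax xb]; rewrite ltNge; apply/negP => px.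
have [||c /[!in_itv]/= /andP[ac cx] pc] := @IVT R (fun x => p.[x]) a x 0 ax.
- by apply: continuous_subspaceT => y; exact: continuous_horner.
- by rewrite ge_min le_max px (ltW pa0) orbT.
- by have := pN0 c; rewrite pc eqxx ac (le_trans cx xb) => /(_ isT).
Qed.

Lemma horner_gt0_bound (p : {poly R}) : (forall x, a <= x <= b -> 0 < p.[x]) ->
  exists2 e, 0 < e & forall x, a <= x <= b -> e <= p.[x].
Proof.
move=> p0; have [|c /[!in_itv]/= cab cP] := @EVT_min R (fun x => p.[x]) a b (ltW ab).
  by apply: continuous_subspaceT => y; exact: continuous_horner.
by exists p.[c]; [exact: p0|move=> x xab; apply: cP; rewrite in_itv].
Qed.

Lemma horner_bound (p : {poly R}) :
  exists2 M, 0 < M & forall x, a <= x <= b -> `|p.[x]| <= M.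
Proof.
have [|c _ cP] := @EVT_max R (fun x => `|p.[x]|) a b (ltW ab).
  apply: continuous_subspaceT => y; apply: continuous_comp; last exact: norm_continuous.
  exact: continuous_horner.
exists (`|p.[c]| + 1) => [|x xab]; first by rewrite ltr_wpDl.
by apply: (le_trans (cP x _)); rewrite ?in_itv// lerDl.
Qed.

Lemma horner_itv_eq0 (p : {poly R}) :
  (forall x, a <= x <= b -> p.[x] = 0) -> p = 0.
Proof.
move=> p0; apply/eqP/negPn/negP => pN0.
(* These are [size p] distinct points of [a, b], more than a nonzero [p] can have as roots. *)
pose rs := [seq a + (b - a) / (k.+1)%:R | k <- iota 0 (size p)].
suff : (size rs < size p)%N by rewrite size_map size_iota ltnn.
have ba0 : 0 < b - a by rewrite subr_gt0.
apply: max_poly_roots => //.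
  apply/allP => _ /mapP[k _ ->]; apply/rootP; apply: p0.
  rewrite lerDl divr_ge0 ?(ltW ba0)//= -lerBrDl.
  by rewrite ler_pdivrMr// ler_peMr ?(ltW ba0)// ler1n.
rewrite map_inj_uniq ?iota_uniq// => i j /addrI /(mulfI (lt0r_neq0 ba0)) /invr_inj.
by move/eqP; rewrite eqr_nat => /eqP [].
Qed.

(* [v] collects the roots of [p] in [[a, b]] with multiplicity, so that any
   polynomial dominated by [p] on [[a, b]] is a multiple of [v]. *)
Lemma itv_root_factorization (p : {poly R}) : p != 0 -> exists v w : {poly R},
  [/\ p = v * w, forall x, a <= x <= b -> 0 < w.[x] &
   forall (d : {poly R}) C, (forall x, a <= x <= b -> `|d.[x]| <= C * `|p.[x]|) ->
     v %| d].
Proof.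
have [m] := ubnP (size p); elim: m p => // m IH p sp p0.
have [[z [zab pz]]|noroot] := pselect (exists z, a <= z <= b /\ root p z).
  have /factor_theorem [p1 pE] := pz.
  have p10 : p1 != 0 by apply: contraNneq p0 => p10; rewrite pE p10 mul0r.
  have sp1 : (size p1 < m)%N.
    by move: sp; rewrite pE size_Mmonic ?monicXsubC// size_XsubC addn2.
  have [v [w [p1E w0 vP]]] := IH p1 sp1 p10.
  exists (v * ('X - z%:P)), w; split => //; first by rewrite pE p1E mulrAC.
  move=> d C dC.
  have /factor_theorem [d1 dE] : root d z.
    apply/rootP; apply/eqP; rewrite -normr_le0 (le_trans (dC z zab))//.
    by rewrite (rootP pz) normr0 mulr0.
  rewrite dE dvdp_mul2r ?polyXsubC_eq0//; apply: (vP _ C) => x xab.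
  (* Cancelling the common factor [X - z] keeps the domination away from [z]; continuity restores it
     at [z]. *)
  have aux y : a <= y <= b -> y != z -> `|d1.[y]| - C * `|p1.[y]| <= 0.
    move=> yab yz; have := dC y yab; rewrite dE pE !hornerM !normrM mulrA.
    by rewrite ler_pM2r ?subr_le0// !hornerE normr_gt0 subr_eq0.
  rewrite -subr_le0; have [xz|xz] := eqVneq x z; last exact: aux.
  rewrite xz; apply: (@continuous_le_except (fun y => `|d1.[y]| - C * `|p1.[y]|)) => //.
  move=> y; apply: cvgB.
    by apply: continuous_comp; [exact: continuous_horner|exact: norm_continuous].
  apply: cvgM; first exact: cvg_cst.
  by apply: continuous_comp; [exact: continuous_horner|exact: norm_continuous].
have pN0 x : a <= x <= b -> p.[x] != 0.
  by move=> xab; apply/negP => px; apply: noroot; exists x.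
have aab : a <= a <= b by rewrite lexx ltW.
(* Without a root in [a, b], [p] has constant sign there; [v] is that sign, so that [w] is
   positive. *)
have [pa|pa|pa] := ltgtP p.[a] 0; last by have := pN0 a aab; rewrite pa eqxx.
  exists (-1), (- p); split; first by rewrite mulrNN mul1r.
    apply: horner_const_sign; last by rewrite hornerN oppr_gt0.
    by move=> x xab; rewrite hornerN oppr_eq0 pN0.
  by move=> d C _; rewrite dvdpNl dvd1p.
exists 1, p; split; first by rewrite mul1r.
  exact: horner_const_sign.
by move=> d C _; rewrite dvd1p.
Qed.

End polynomials_on_an_interval.

Section monic_polynomials.
Variable R : idomainType.
Implicit Types p r s t : {poly R}.

Lemma monicD p r : p \is monic -> (size r < size p)%N ->
  (p + r \is monic) * (size (p + r) = size p).
Proof.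
move=> mp rp; split; last by rewrite size_polyDl.
by rewrite monicE lead_coefDl// -monicE.
Qed.

Lemma size_monicB n s t : s \is monic -> size s = n.+1 -> t \is monic ->
  size t = n.+1 -> (size (s - t)%R <= n)%N.
Proof.
rewrite !monicE !lead_coefE => /eqP + ss /eqP + st; rewrite ss st /= => ms mt.
apply/leq_sizeP => j nj; rewrite coefB.
move: nj; rewrite leq_eqVlt => /predU1P[<-|nj]; first by rewrite ms mt subrr.
by rewrite !nth_default ?ss ?st// subrr.
Qed.

End monic_polynomials.

(** * Existence of a monic polynomial minimizing a given norm *)

Section norm_minimizer.
Variables (R : realType) (N : {poly R} -> R).
Hypothesis N_ge0 : forall p, 0 <= N p.
Hypothesis ND : forall p r, N (p + r) <= N p + N r.
Hypothesis NZ : forall c p, N (c *: p) = `|c| * N p.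
Hypothesis N_eq0 : forall p, N p = 0 -> p = 0.

Let N0 : N 0 = 0.
Proof. by rewrite -(scale0r (0 : {poly R})) NZ normr0 mul0r. Qed.

Let NN p : N (- p) = N p.
Proof. by rewrite -scaleN1r NZ normrN1 mul1r. Qed.

Let N_dist p r : `|N p - N r| <= N (p - r).
Proof.
have h (s t : {poly R}) : N s - N t <= N (s - t).
  by rewrite lerBlDr -{1}(subrK t s) ND.
by rewrite ler_norml h andbT lerNl opprB (le_trans (h r p))// -NN opprB.
Qed.

Let N_sum (I : Type) (l : seq I) (p : I -> {poly R}) :
  N (\sum_(i <- l) p i) <= \sum_(i <- l) N (p i).
Proof.
elim: l => [|i l IH]; first by rewrite !big_nil N0.
by rewrite !big_cons (le_trans (ND _ _))// lerD2l.
Qed.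

(** One half of the equivalence of [N] with the max norm of coefficients; it makes [N] continuous in
    them. *)
Let N_rVpoly n (v : 'rV[R]_n) : N (rVpoly v) <= `|v| * \sum_(i < n) N 'X^i.
Proof.
have -> : rVpoly v = \sum_(i < n) v 0 i *: 'X^i.
  rewrite /rVpoly poly_def; apply: eq_bigr => i _.
  by rewrite valK.
rewrite (le_trans (N_sum _ _))// mulr_sumr; apply: ler_sum => i _.
rewrite NZ ler_wpM2r//.
have := le_bigmax_cond; rewrite /Num.Def.normr/= mx_normrE => _.
exact: (le_bigmax _ (fun ij : 'I_1 * 'I_n => `|v ij.1 ij.2|) (0, i)).
Qed.

Let N_rVpoly_continuous n (r : {poly R}) :
  continuous (fun v : 'rV[R]_n => N (r + rVpoly v)).
Proof.
move=> v; apply/(@cvgrPdist_lt _ R^o _ _ (nbhs_filter v)) => e e0.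
pose S := \sum_(i < n) N 'X^i + 1.
have S0 : 0 < S by rewrite ltr_wpDl// sumr_ge0.
apply/nbhs_ballP; exists (e / S) => /=; first exact: divr_gt0.
move=> u; rewrite -ball_normE/= ltr_pdivlMr// => uv.
apply: le_lt_trans uv; rewrite (le_trans (N_dist _ _))//.
rewrite opprD addrACA subrr add0r -linearB/= (le_trans (N_rVpoly _))//.
by rewrite ler_wpM2l// lerDl.
Qed.

(** The constant is the minimum of [N] on the compact unit sphere, positive because [N] vanishes
    only at 0. *)
Let N_rVpoly_lower n : exists2 e, 0 < e & forall v : 'rV[R]_n, e * `|v| <= N (rVpoly v).
Proof.
(* For [n = 0] the sphere is empty and any constant will do. *)
have [[v0 v0N0]|h] := pselect (exists v : 'rV[R]_n, v != 0); last first.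
  exists 1 => // v; suff -> : v = 0 by rewrite normr0 mulr0.
  by apply/eqP/negPn/negP => v0; apply: h; exists v.
pose S := [set v : 'rV[R]_n | `|v| = 1].
have nv0 (v : 'rV[R]_n) : v != 0 -> S (`|v|^-1 *: v).
  by move=> vN0; rewrite /S/= normrZ normfV normr_id mulVf// normr_eq0.
have cS : compact S.
  apply: bounded_closed_compact.
    by exists 1; split => // x x1 v/= ->; exact: ltW.
  apply: (@closed_comp _ _ (fun v : 'rV[R]_n => `|v|) [set 1]).
    by move=> v _; exact: norm_continuous.
  exact: closed_eq.
have [||v /[!inE] Sv vP] := @compact_EVT_min _ R (fun v : 'rV[R]_n => N (0 + rVpoly v)) S _ cS.
- by exists (`|v0|^-1 *: v0); exact: nv0.
- by apply: continuous_subspaceT => x; exact: N_rVpoly_continuous.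
exists (N (rVpoly v)).
  rewrite lt_neqAle N_ge0 andbT eq_sym; apply/eqP => /N_eq0 v00.
  have : v = 0 by rewrite -[v]rVpolyK v00 linear0.
  by move=> vE; move: Sv; rewrite /S/= vE normr0 => /esym/eqP; rewrite oner_eq0.
move=> u; have [->|u0] := eqVneq u 0; first by rewrite normr0 mulr0.
have := vP (`|u|^-1 *: u); rewrite inE => /(_ (nv0 _ u0)).
rewrite !add0r linearZ/= NZ normfV normr_id mulrC.
by rewrite ler_pdivlMr ?normr_gt0.
Qed.

Lemma monic_minimizer n : exists t : {poly R}, [/\ t \is monic, size t = n.+1 &
  forall s : {poly R}, s \is monic -> size s = n.+1 -> N t <= N s].
Proof.
have [e e0 eP] := N_rVpoly_lower n.
(* If |u| > r, then [N (rVpoly u)] is at least twice [N 'X^n], so adding [rVpoly u] to ['X^n] cannot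
   lower the norm; the search is confined to a compact ball. *)
pose r := 2 * N 'X^n / e.
have r0 : 0 <= r by rewrite divr_ge0 ?mulr_ge0// ltW.
pose B := [set v : 'rV[R]_n | `|v| <= r].
have cB : compact B.
  apply: bounded_closed_compact.
    by exists r; split => [|x rx v/= vr]; [exact: num_real|exact: le_trans vr (ltW rx)].
  apply: (@closed_comp _ _ (fun v : 'rV[R]_n => `|v|) [set x | x <= r]).
    by move=> v _; exact: norm_continuous.
  exact: closed_le.
have B0 : B 0 by rewrite /B/= normr0.
have [||v /[!inE] Bv vP] :=
  @compact_EVT_min _ R (fun v : 'rV[R]_n => N ('X^n + rVpoly v)) B _ cB.
- by exists 0.
- by apply: continuous_subspaceT => x; exact: N_rVpoly_continuous.
have sv := size_poly n (fun k => if insub k is Some i then v 0 i else 0).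
have sXn : size ('X^n : {poly R}) = n.+1 by rewrite size_polyXn.
have [|mt st] := @monicD _ 'X^n (rVpoly v) (monicXn _ n); first by rewrite sXn ltnS.
exists ('X^n + rVpoly v); split => //; first by rewrite st.
move=> s ms ss.
have sE : s = 'X^n + rVpoly (poly_rV (s - 'X^n) : 'rV_n).
  by rewrite poly_rV_K; [rewrite subrKC|exact: size_monicB (monicXn _ n) sXn].
rewrite sE; set u := poly_rV _.
have [ur|ru] := leP `|u| r; first by apply: vP; rewrite inE.
have h0 : N ('X^n + rVpoly v) <= N 'X^n.
  by have := vP 0; rewrite linear0 addr0 inE; apply.
have h1 : N (rVpoly u) <= N ('X^n + rVpoly u) + N 'X^n.
  by rewrite -(NN 'X^n) -{1}(addKr 'X^n (rVpoly u)) addrC ND.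
have h2 : 2 * N 'X^n <= N (rVpoly u).
  by apply: le_trans (eP u); rewrite [e * _]mulrC -ler_pdivrMr// ltW.
by lra.
Qed.

End norm_minimizer.

(** * Lp norms of continuous functions *)

(** [fine] sends an infinite norm to 0; for continuous [f] and [1 <= p] the norm is finite and
    nothing is lost ([LpN_continuous_fin]). *)
Definition realLpN (R : realType) (p : \bar R) (a b : R) (f : R -> R) : R :=
  fine (LpN p a b f).

Lemma norm_powR_continuous (R : realType) (r : R) : 0 < r ->
  continuous (fun y : R => `|y| `^ r).
Proof.
move=> r0 y; have [->|y0] := eqVneq y 0; last first.
  apply: (@continuous_comp _ _ _ (fun y : R => `|y|) (fun y => y `^ r)).
    exact: norm_continuous.
  apply/differentiable_continuous/derivable1_diffP/derivable_powR.
  by rewrite in_itv/= andbT normr_gt0.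
apply/cvgrPdist_lt => e e0; apply/nbhs_ballP; exists (e `^ r^-1) => /=.
  exact: powR_gt0.
move=> x; rewrite /ball/= sub0r normrN => xe.
rewrite normr0 powR0 ?gt_eqF// sub0r normrN ger0_norm ?powR_ge0//.
have -> : e = (e `^ r^-1) `^ r by rewrite -powRrM mulVf ?gt_eqF// powRr1// ltW.
by apply: gt0_ltr_powR; rewrite ?nnegrE ?powR_ge0.
Qed.

Lemma ler_norm_powR (R : realType) (r x y : R) : 0 < r -> `|x| <= `|y| ->
  `|x| `^ r <= `|y| `^ r.
Proof.
move=> r0; apply: ge0_ler_powR; first exact: ltW.
- exact: normr_ge0.
- exact: normr_ge0.
Qed.

Lemma norm_powR_inj (R : realType) (r x y : R) : 0 < r ->
  `|x| `^ r = `|y| `^ r -> `|x| = `|y|.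
Proof.
move=> r0; apply: (powR_injective r0); exact: normr_ge0.
Qed.

Section Lp_norm_continuous.
Variables (R : realType) (a b : R).
Hypothesis ab : a < b.
Notation mu := (@lebesgue_measure R).
Implicit Types (f g : R -> R) (r c M : R) (p q : \bar R).

Lemma continuous_itv_integrable f : continuous f -> mu.-integrable `[a, b] (EFin \o f).
Proof.
move=> cf; apply: continuous_compact_integrable; first exact: segment_compact.
by apply: continuous_subspaceT => x; exact: cf.
Qed.

Lemma continuous_comp_norm_powR r f : 0 < r -> continuous f ->
  continuous (fun x => `|f x| `^ r).
Proof.
move=> r0 cf x; apply: (@continuous_comp _ _ _ f (fun y => `|y| `^ r)).
  exact: cf.
exact: norm_powR_continuous.
Qed.

Lemma continuous_comp_norm f : continuous f -> continuous (fun x => `|f x|).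
Proof.
by move=> cf x; apply: (@continuous_comp _ _ _ f); [exact: cf|exact: norm_continuous].
Qed.

Lemma continuous_measurable_fun (A : set R) f : measurable A -> continuous f ->
  measurable_fun A f.
Proof.
move=> mA cf; apply: measurable_funTS.
exact: continuous_measurable_fun.
Qed.

(** The integral is at least the minimum of [f] on an interval of positivity times its length. *)
Lemma Rintegral_continuous_gt0 f (z : R) : continuous f ->
  (forall x, a <= x <= b -> 0 <= f x) -> a <= z <= b -> 0 < f z ->
  0 < \int[mu]_(x in `[a, b]) f x.
Proof.
move=> cf f0 zab fz.
have [c [d [ac cd db cdP]]] := continuous_gt0_subitv ab cf zab fz.
have cdab : `[c, d] `<=` `[a, b].
  by move=> x/=; rewrite !in_itv/=; lra.
have [|y /[!in_itv]/= ycd yP] := @EVT_min R f c d (ltW cd).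
  by apply: continuous_subspaceT => x; exact: cf.
apply: (@lt_le_trans _ _ (f y * (d - c))).
  by rewrite mulr_gt0 ?subr_gt0// cdP.
rewrite -lee_fin EFin_Rintegral//; last exact: continuous_itv_integrable.
apply: (@le_trans _ _ (\int[mu]_(x in `[c, d]) (f x)%:E)%E); last first.
  apply: ge0_subset_integral => //.
    apply/measurable_EFinP; exact: continuous_measurable_fun.
have -> : (f y * (d - c))%:E = (\int[mu]_(x in `[c, d]) (f y)%:E)%E.
  by rewrite integral_cst//= lebesgue_measure_itv/= lte_fin cd EFinM.
apply: ge0_le_integral => //=.
- by move=> x _; rewrite lee_fin ltW// cdP.
- apply/measurable_EFinP; exact: continuous_measurable_fun.
Qed.

Lemma LpN_EFinE r f : 0 < r -> continuous f ->
  LpN r%:E a b f = ((\int[mu]_(x in `[a, b]) `|f x| `^ r) `^ r^-1)%:E.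
Proof.
move=> r0 cf; rewrite /LpN unlock -poweR_EFin; congr (_ `^ _)%E.
rewrite EFin_Rintegral//; last first.
  by apply: continuous_itv_integrable; exact: continuous_comp_norm_powR.
rewrite [RHS]integral_mkcond/=; apply: eq_integral => x _.
rewrite /restrict/=; case: ifPn => // _.
by rewrite abse0 poweR0r// gt_eqF.
Qed.

(** The definition of [Lnorm] at [+oo] tests this before it returns the essential supremum. *)
Lemma lebesgue_measureT_gt0 : (0 < mu [set: R])%E.
Proof.
apply: (@lt_le_trans _ _ (mu `[a, b])).
  by rewrite lebesgue_measure_itv/= lte_fin ab -EFinD lte_fin subr_gt0.
by apply: le_measure; rewrite ?inE.
Qed.

Lemma LpN_ooE f : LpN +oo a b f = ess_sup mu (abse \o ((EFin \o f) \_ `[a, b])).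
Proof. by rewrite /LpN unlock lebesgue_measureT_gt0. Qed.

Lemma LpN_ge0 p f : (0 <= LpN p a b f)%E.
Proof. exact: Lnorm_ge0. Qed.

(** A continuous function exceeding [M] at one point exceeds it on a nondegenerate interval, which
    is not null; so the essential supremum is a true one. *)
Lemma LpN_oo_leP f M : continuous f -> 0 <= M ->
  (LpN +oo a b f <= M%:E)%E <-> (forall x, a <= x <= b -> `|f x| <= M).
Proof.
move=> cf M0; rewrite LpN_ooE; split; last first.
  move=> fM; apply/ess_supP; apply/aeW => x /=; rewrite patchE; case: ifPn.
    by rewrite inE/= in_itv/= lee_fin => /fM.
  by rewrite abse0 lee_fin.
move=> /ess_supP [N [mN N0 NP]] z zab; rewrite leNgt; apply/negP => fz.
have cfM : continuous (fun x => `|f x| - M).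
  by move=> x; apply: cvgB; [exact: continuous_comp_norm|exact: cvg_cst].
have [|c [d [ac cd db cdP]]] := continuous_gt0_subitv ab cfM zab.
  by rewrite subr_gt0.
have cdN : `[c, d] `<=` N.
  move=> x/= xcd; apply: NP => /=; apply/negP; rewrite -ltNge patchE mem_set/=.
    by rewrite lte_fin -subr_gt0; apply: cdP; move: xcd; rewrite in_itv.
  by move: xcd; rewrite !in_itv/=; lra.
have : (mu `[c, d] <= mu N)%E by apply: le_measure; rewrite ?inE.
by rewrite N0 lebesgue_measure_itv/= lte_fin cd -EFinD lee_fin; lra.
Qed.

Lemma LpN_continuous_fin p f : (1 <= p)%E -> continuous f ->
  LpN p a b f = (realLpN p a b f)%:E.
Proof.
case: p => [r||//] p1 cf; rewrite /realLpN.
  by rewrite LpN_EFinE// (lt_le_trans ltr01)// -lee_fin.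
have [|M M0 fM] := @continuous_itv_bounded R a b f (ltW ab).
  by apply: continuous_subspaceT => x; exact: cf.
rewrite fineK// ge0_fin_numE; last exact: LpN_ge0.
by apply: (@le_lt_trans _ _ M%:E); rewrite ?ltry//; apply/LpN_oo_leP => //; exact: ltW.
Qed.

Lemma realLpN_ge0 p f : 0 <= realLpN p a b f.
Proof. by apply: fine_ge0; exact: LpN_ge0. Qed.

Lemma realLpN_EFinE r f : 0 < r -> continuous f ->
  realLpN r%:E a b f = (\int[mu]_(x in `[a, b]) `|f x| `^ r) `^ r^-1.
Proof. by move=> r0 cf; rewrite /realLpN LpN_EFinE. Qed.

Lemma realLpN_oo_leP f M : continuous f -> 0 <= M ->
  realLpN +oo a b f <= M <-> (forall x, a <= x <= b -> `|f x| <= M).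
Proof.
by move=> cf M0; rewrite -LpN_oo_leP// LpN_continuous_fin// ?lee_fin// leey.
Qed.

Lemma norm_le_realLpN_oo f x : continuous f -> a <= x <= b -> `|f x| <= realLpN +oo a b f.
Proof.
move=> cf; have [+ _] := realLpN_oo_leP cf (realLpN_ge0 +oo f).
by move=> /(_ (lexx _)); apply.
Qed.

Lemma le_realLpN p f g : (1 <= p)%E -> continuous f -> continuous g ->
  (forall x, a <= x <= b -> `|f x| <= `|g x|) -> realLpN p a b f <= realLpN p a b g.
Proof.
case: p => [r||//] p1 cf cg fg; last first.
  apply/realLpN_oo_leP => //; first exact: realLpN_ge0.
  by move=> x xab; rewrite (le_trans (fg x xab))// norm_le_realLpN_oo.
have r0 : 0 < r by rewrite (lt_le_trans ltr01)// -lee_fin.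
rewrite (realLpN_EFinE r0 cf) (realLpN_EFinE r0 cg); apply: ge0_ler_powR.
- by rewrite invr_ge0 ltW.
- by rewrite nnegrE; apply: Rintegral_ge0 => x _; exact: powR_ge0.
- by rewrite nnegrE; apply: Rintegral_ge0 => x _; exact: powR_ge0.
apply: le_Rintegral => //.
- by apply: continuous_itv_integrable; exact: continuous_comp_norm_powR.
- by apply: continuous_itv_integrable; exact: continuous_comp_norm_powR.
- by move=> x /=; rewrite in_itv/= => /fg h; exact: ler_norm_powR.
Qed.

(** The difference of the r-th powers is continuous, nonnegative and of integral 0. *)
Lemma realLpN_strict r f g : 1 <= r -> continuous f -> continuous g ->
  (forall x, a <= x <= b -> `|f x| <= `|g x|) ->
  realLpN r%:E a b f = realLpN r%:E a b g ->
  forall x, a <= x <= b -> `|f x| = `|g x|.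
Proof.
move=> r1 cf cg fg; have r0 : 0 < r by rewrite (lt_le_trans ltr01).
have ifr : mu.-integrable `[a, b] (EFin \o (fun x => `|f x| `^ r)).
  by apply: continuous_itv_integrable; exact: continuous_comp_norm_powR.
have igr : mu.-integrable `[a, b] (EFin \o (fun x => `|g x| `^ r)).
  by apply: continuous_itv_integrable; exact: continuous_comp_norm_powR.
have Inneg (h : R -> R) : \int[mu]_(x in `[a, b]) `|h x| `^ r \in Num.nneg.
  by rewrite nnegrE; apply: Rintegral_ge0 => x _; exact: powR_ge0.
rewrite (realLpN_EFinE r0 cf) (realLpN_EFinE r0 cg) => E0.
have r'0 : 0 < r^-1 by rewrite invr_gt0.
have E := powR_injective r'0 (Inneg f) (Inneg g) E0.
move=> x xab; apply: (norm_powR_inj r0); apply/eqP.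
rewrite eq_le (ler_norm_powR r0 (fg x xab))/= leNgt; apply/negP => lt.
have ch : continuous (fun x => `|g x| `^ r - `|f x| `^ r).
  by move=> y; apply: cvgB; exact: continuous_comp_norm_powR.
have h0 y : a <= y <= b -> 0 <= `|g y| `^ r - `|f y| `^ r.
  by move=> yab; rewrite subr_ge0 (ler_norm_powR r0 (fg y yab)).
have hx : 0 < `|g x| `^ r - `|f x| `^ r by rewrite subr_gt0.
have EB := RintegralB _ igr ifr; have {}EB := EB (measurable_itv _).
have := Rintegral_continuous_gt0 ch h0 xab hx.
rewrite EB lt_neqAle eq_sym subr_eq0 => /andP[/eqP h1 _]; case: h1; exact: esym E.
Qed.

Lemma realLpND p f g : (1 <= p)%E -> continuous f -> continuous g ->
  realLpN p a b (fun x => f x + g x) <= realLpN p a b f + realLpN p a b g.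
Proof.
move=> p1 cf cg.
have cfg : continuous (fun x => f x + g x).
  by move=> x; apply: cvgD; [exact: cf|exact: cg].
rewrite -lee_fin EFinD -!LpN_continuous_fin// /LpN !restrict_EFin.
have -> : (fun x => f x + g x) \_ `[a, b] = (f \_ `[a, b]) \+ (g \_ `[a, b]).
  by apply/funext => x /=; rewrite !patchE; case: ifPn => // _; rewrite addr0.
by apply: eminkowski => //; apply/(measurable_restrictT _ _).1 => //;
  exact: continuous_measurable_fun.
Qed.

Lemma realLpNZ p f c : (1 <= p)%E -> continuous f ->
  realLpN p a b (fun x => c * f x) = `|c| * realLpN p a b f.
Proof.
move=> p1.
(* One inequality suffices: the reverse one is the same inequality for [c^-1] and [c * f]. *)
suff h c' f' : continuous f' ->
    realLpN p a b (fun x => c' * f' x) <= `|c'| * realLpN p a b f'.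
  move=> cf; apply/eqP; rewrite eq_le h//=.
  have [->|c0] := eqVneq c 0; first by rewrite normr0 mul0r realLpN_ge0.
  rewrite -ler_pdivlMl ?normr_gt0// -normfV (le_trans _ (h _ _ _))//.
    by rewrite le_eqVlt; apply/orP; left; apply/eqP; congr realLpN;
      apply/funext => x; rewrite mulrA mulVf// mul1r.
  by move=> x; apply: cvgM; [exact: cvg_cst|exact: cf].
move=> cf; have ccf : continuous (fun x => c' * f' x).
  by move=> x; apply: cvgM; [exact: cvg_cst|exact: cf].
case: p p1 => [r||//] p1; last first.
  apply/realLpN_oo_leP => //; first by rewrite mulr_ge0// realLpN_ge0.
  by move=> x xab; rewrite normrM ler_wpM2l// norm_le_realLpN_oo.
have r0 : 0 < r by rewrite (lt_le_trans ltr01)// -lee_fin.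
rewrite !realLpN_EFinE//.
have -> : \int[mu]_(x in `[a, b]) `|c' * f' x| `^ r =
    `|c'| `^ r * \int[mu]_(x in `[a, b]) `|f' x| `^ r.
  rewrite -RintegralZl//.
    by apply: eq_Rintegral => x _; rewrite normrM powRM.
  by apply: continuous_itv_integrable; exact: continuous_comp_norm_powR.
rewrite powRM ?powR_ge0//; last by apply: Rintegral_ge0 => x _; exact: powR_ge0.
by rewrite -powRrM mulfV ?gt_eqF// powRr1.
Qed.

Lemma realLpN_horner_eq0 p (s : {poly R}) : (1 <= p)%E ->
  realLpN p a b (fun x => s.[x]) = 0 -> s = 0.
Proof.
have cs : continuous (fun x => s.[x]) by exact: continuous_horner.
case: p => [r||//] p1 s0; apply: (horner_itv_eq0 ab) => x xab; apply/eqP; last first.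
  by rewrite -normr_le0 -s0 norm_le_realLpN_oo.
have c0 : continuous (fun _ : R => 0 : R) by move=> y; exact: cvg_cst.
rewrite -normr_eq0 -(@realLpN_strict r (fun=> 0) (fun x => s.[x]) _ _ _ _ _ x xab)//.
- by rewrite normr0.
- by move=> y _; rewrite normr0.
- by have := realLpNZ 0 p1 cs; rewrite s0 mulr0; under eq_fun do rewrite mul0r.
Qed.

End Lp_norm_continuous.

Section affine_change_of_variable.
Variables (R : realType) (a b : R).
Hypothesis ab : a < b.
Notation mu := (@lebesgue_measure R).
Let L := (b - a) / 2.
Let T (y : R) := L * y + (a + b) / 2.

Let L0 : 0 < L. Proof. by rewrite divr_gt0// subr_gt0. Qed.

Let T_continuous : continuous T.
Proof.
move=> y; apply: cvgD; last exact: cvg_cst.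
by apply: cvgM; [exact: cvg_cst|exact: cvg_id].
Qed.

Let m1_lt1 : (-1 : R) < 1. Proof. by lra. Qed.

Let is_derive_T (y : R) : is_derive y (1 : R) T L.
Proof.
have -> : L = (L%:P * 'X + ((a + b) / 2)%:P)^`().[y].
  by rewrite derivD derivM !derivC derivX mul0r add0r mulr1 addr0 hornerC.
have -> : T = horner (L%:P * 'X + ((a + b) / 2)%:P).
  by apply/funext => z; rewrite !hornerE.
exact: is_derive_poly.
Qed.

Lemma Rintegral_affine (g : R -> R) : continuous g ->
  \int[mu]_(x in `[a, b]) g x = L * \int[mu]_(y in `[-1, 1]) g (T y).
Proof.
move=> cg.
have cgT : continuous (fun y => g (T y)).
  by move=> y; apply: (@continuous_comp _ _ _ T g); [exact: T_continuous|exact: cg].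
have igT := continuous_itv_integrable (-1) 1 cgT.
rewrite -RintegralZl//; congr fine.
have dT : derive1 T = cst L.
  by apply/funext => y; rewrite derive1E; exact: derive_val.
have Ta : T (-1) = a by rewrite /T /L; field.
have Tb : T 1 = b by rewrite /T /L; field.
rewrite -{1}Ta -{1}Tb integration_by_substitution_increasing ?ltW//.
- by apply: eq_integral => y _; rewrite dT /= mulrC.
- by move=> x y _ _ xy; rewrite /T ltrD2r ltr_pM2l.
- by rewrite dT => y _; exact: cvg_cst.
- by rewrite dT; exact: is_cvg_cst.
- by rewrite dT; exact: is_cvg_cst.
- split.
  + by move=> y _; exact: ex_derive.
  + by apply: cvg_at_right_filter; exact: T_continuous.
  + by apply: cvg_at_left_filter; exact: T_continuous.
- by apply: continuous_subspaceT => x; exact: cg.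
Qed.

(** The Jacobian [L] leaves the integral under the power 1/q; at [q = +oo] the exponent is 0 and the
    two suprema agree. *)
Lemma realLpN_affine (q : \bar R) (f : R -> R) : (1 <= q)%E -> continuous f ->
  realLpN q a b f = L `^ inv_exp q * realLpN q (-1) 1 (fun y => f (T y)).
Proof.
move=> q1 cf.
have cfT : continuous (fun y => f (T y)).
  by move=> y; apply: (@continuous_comp _ _ _ T f); [exact: T_continuous|exact: cf].
case: q q1 => [r||//] q1.
  have r0 : 0 < r by rewrite (lt_le_trans ltr01)// -lee_fin.
  rewrite !realLpN_EFinE// Rintegral_affine; last exact: continuous_comp_norm_powR.
  rewrite powRM//; first exact: ltW.
  by apply: Rintegral_ge0 => x _; exact: powR_ge0.
move: q1 => _; rewrite /= powRr0 mul1r; apply/eqP; rewrite eq_le; apply/andP; split.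
  apply/(realLpN_oo_leP ab cf (realLpN_ge0 _ _ _ _)) => x xab.
  have ba0 : 0 < b - a by rewrite subr_gt0.
  have -> : x = T ((2 * x - a - b) / (b - a)).
    by rewrite /T /L; field; rewrite gt_eqF.
  apply: (norm_le_realLpN_oo m1_lt1 cfT).
  by rewrite ler_pdivlMr// ler_pdivrMr//; lra.
apply/(realLpN_oo_leP m1_lt1 cfT (realLpN_ge0 _ _ _ _)) => y y1.
apply: (norm_le_realLpN_oo ab cf).
have h1 : 0 <= L * (y + 1) by rewrite mulr_ge0 ?(ltW L0)//; lra.
have h2 : 0 <= L * (1 - y) by rewrite mulr_ge0 ?(ltW L0)//; lra.
have Ta : a = - L + (a + b) / 2 by rewrite /L; field.
have Tb : b = L + (a + b) / 2 by rewrite /L; field.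
by rewrite /T; lra.
Qed.

End affine_change_of_variable.

(** * Hoelder's inequality for all conjugate exponents *)

Section hoelder_on_an_interval.
Variables (R : realType) (a b : R).
Hypothesis ab : a < b.
Notation mu := (@lebesgue_measure R).
Implicit Types (f g : R -> R) (p q : \bar R).

Lemma conj_exp_cases p q : conj_exp p q ->
  [\/ [/\ p = 1%E & q = +oo%E], [/\ p = +oo%E & q = 1%E] |
    exists r s : R, [/\ p = r%:E, q = s%:E, 1 < r, 1 < s & r^-1 + s^-1 = 1]].
Proof.
have inv1 (x : R) : 1 <= x -> x^-1 = 1 -> x = 1.
  by move=> x1 xE; rewrite -[x]invrK xE invr1.
move=> [p1 [q1]]; case: p p1 => [r||//]; case: q q1 => [s||//] /=.
- rewrite !lee_fin => s1 r1 rs; apply: Or33; exists r, s; split => //.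
    rewrite lt_neqAle r1 andbT eq_sym; apply: contra_eq_neq rs => ->.
    by rewrite invr1 gt_eqF// ltrDl invr_gt0 (lt_le_trans ltr01).
  rewrite lt_neqAle s1 andbT eq_sym; apply: contra_eq_neq rs => ->.
  by rewrite invr1 gt_eqF// ltrDr invr_gt0 (lt_le_trans ltr01).
- rewrite lee_fin addr0 => _ r1 /(inv1 _ r1) ->; exact: Or31.
- rewrite lee_fin add0r => s1 _ /(inv1 _ s1) ->; exact: Or32.
- by move=> _ _ /eqP; rewrite addr0 eq_sym oner_eq0.
Qed.

Lemma LpN1E f : LpN 1 a b f = (\int[mu]_(x in `[a, b]) `|f x|%:E)%E.
Proof.
rewrite /LpN Lnorm1 [RHS]integral_mkcond/=; apply: eq_integral => x _.
by rewrite /restrict; case: ifPn => // _; rewrite abse0.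
Qed.

(** The endpoint cases of Hoelder. The bound is only a.e. so that the merely essentially bounded
    factor of the case [p = +oo] can serve as [g]. *)
Lemma integral_norm_mul_le f g (M : R) :
  measurable_fun `[a, b] f -> measurable_fun `[a, b] g -> 0 <= M ->
  {ae mu, forall x, `[a, b]%classic x -> `|g x| <= M} ->
  (\int[mu]_(x in `[a, b]) `|f x * g x|%:E <=
   (\int[mu]_(x in `[a, b]) `|f x|%:E) * M%:E)%E.
Proof.
move=> mf mg M0 gM.
have mnf : measurable_fun `[a, b] (fun x => `|f x|%:E).
  by apply/measurable_EFinP; exact: measurableT_comp.
rewrite -ge0_integralZr//.
apply: ae_ge0_le_integral => //.
- by apply/measurable_EFinP; apply: measurableT_comp => //; exact: measurable_funM.
- by move=> x _; rewrite -EFinM lee_fin mulr_ge0.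
- by apply: emeasurable_funM => //; exact: measurable_cst.
- move: gM; apply: filterS; first exact: (ae_filter_ringOfSetsType mu).
  by move=> x gx xab; rewrite -EFinM lee_fin normrM ler_wpM2l// gx.
Qed.

Lemma LpN_hoelder p q f g : conj_exp p q -> measurable_fun `[a, b] f ->
  (LpN p a b f < +oo)%E -> continuous g ->
  (\int[mu]_(x in `[a, b]) `|f x * g x|%:E <= LpN p a b f * LpN q a b g)%E.
Proof.
move=> pq mf fp cg.
have mg : measurable_fun `[a, b] g by exact: continuous_measurable_fun.
have [[pE qE]|[pE qE]|[r [s [pE qE r1 s1 rs]]]] := conj_exp_cases pq.
- rewrite pE qE LpN1E (LpN_continuous_fin ab) ?leey//.
  apply: integral_norm_mul_le => //; first exact: realLpN_ge0.
  by apply/aeW => x; rewrite /= in_itv/= => xab; exact: norm_le_realLpN_oo.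
- rewrite pE in fp *; rewrite qE LpN1E muleC.
  have fin : LpN +oo a b f \is a fin_num by rewrite ge0_fin_numE//; exact: LpN_ge0.
  rewrite -(fineK fin).
  under eq_integral do rewrite mulrC.
  apply: integral_norm_mul_le => //; first by apply: fine_ge0; exact: LpN_ge0.
  have : (ess_sup mu (abse \o ((EFin \o f) \_ `[a, b])) <= (fine (LpN +oo a b f))%:E)%E.
    by rewrite fineK// (LpN_ooE ab).
  move=> /ess_supP; apply: filterS.
  by move=> x /= + xab; rewrite patchE mem_set//= lee_fin.
- have r0 : 0 < r by rewrite (lt_trans ltr01).
  have s0 : 0 < s by rewrite (lt_trans ltr01).
  rewrite pE qE /LpN !restrict_EFin.
  have mfT : measurable_fun setT (f \_ `[a, b]) by exact/(measurable_restrictT _ _).1.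
  have mgT : measurable_fun setT (g \_ `[a, b]) by exact/(measurable_restrictT _ _).1.
  have := hoelder mu mfT mgT r0 s0 rs; rewrite Lnorm1; apply: le_trans.
  rewrite [leLHS]integral_mkcond.
  set F1 := (X in (integral _ _ X <= _)%E); set F2 := (X in (_ <= integral _ _ X)%E).
  suff -> : F1 = F2 by [].
  apply/funext => x; rewrite /F1 /F2 /= !patchE; case: ifPn => // _.
  by rewrite mul0r normr0.
Qed.

End hoelder_on_an_interval.

(** * Monic polynomials of least norm *)

Section unique_minimizer.
Variables (R : realType) (a b : R) (n : nat).
Hypothesis ab : a < b.
Implicit Types (s t u : {poly R}) (q : \bar R).

Let is_minimizer q s := forall s', s' \is monic -> size s' = n.+1 ->
  realLpN q a b (fun x => s.[x]) <= realLpN q a b (fun x => s'.[x]).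

Let midpoint s t : let u := 2^-1 *: (s + t) in let d := 2^-1 *: (s - t) in
  (s = u + d) * (t = u - d) * (u = s - d).
Proof.
have h : 2^-1 + 2^-1 = 1 :> R by field.
have hs : s = 2^-1 *: s + 2^-1 *: s by rewrite -scalerDl h scale1r.
have ht : t = 2^-1 *: t + 2^-1 *: t by rewrite -scalerDl h scale1r.
rewrite /= !scalerDr scalerN; split; first split.
- by rewrite addrACA subrr addr0 -hs.
- by rewrite opprB addrC addrA subrK -ht.
- by rewrite [X in _ = X - _]hs opprB addrA [RHS]addrAC addrK.
Qed.

Lemma minimizer_unique_fin (r : R) s t : 1 <= r ->
  s \is monic -> size s = n.+1 -> t \is monic -> size t = n.+1 ->
  is_minimizer r%:E s -> is_minimizer r%:E t -> s = t.
Proof.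
move=> r1 ms ss mt st mins mint.
pose N f := realLpN r%:E a b f.
have r1e : (1 <= r%:E)%E by rewrite lee_fin.
have cp (p : {poly R}) : continuous (fun x => p.[x]) by exact: continuous_horner.
have cnp (p : {poly R}) : continuous (fun x => `|p.[x]|).
  exact: continuous_comp_norm.
pose u := 2^-1 *: (s + t); pose d := 2^-1 *: (s - t).
have [[sE tE] uE] := midpoint s t; rewrite -/u -/d in sE tE uE.
have sd : (size d <= n)%N.
  by rewrite (leq_trans (size_scale_leq _ _))// (size_monicB ms ss mt st).
have [mu su] : (u \is monic) /\ size u = n.+1.
  rewrite uE; have [|m1 ->] := @monicD _ s (- d) ms; last by rewrite ss.
  by rewrite size_polyN ss ltnS.
(* [h] dominates |u|, and by Minkowski its norm is at most the minimal one; as [u] is itself a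
   competitor, |u| = h on [a, b]. *)
pose h x := 2^-1 * (`|s.[x]| + `|t.[x]|).
have ch : continuous h.
  move=> x; apply: cvgM; first exact: cvg_cst.
  by apply: cvgD; exact: cnp.
have Nst : N (fun x => s.[x]) = N (fun x => t.[x]).
  by apply/eqP; rewrite eq_le mins// mint.
have Nnorm (p : {poly R}) : N (fun x => `|p.[x]|) <= N (fun x => p.[x]).
  by apply: le_realLpN => // x _; rewrite normr_id.
have Nh : N h <= N (fun x => s.[x]).
  have c2 : continuous (fun x => `|s.[x]| + `|t.[x]|).
    by move=> x; apply: cvgD; exact: cnp.
  rewrite /N /h (realLpNZ ab _ r1e c2) ger0_norm ?invr_ge0// ler_pdivrMl//.
  rewrite (le_trans (realLpND ab r1e (cnp s) (cnp t)))//.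
  have := Nnorm s; have := Nnorm t; rewrite -Nst /N; move: r1e => _; lra.
have uh x : a <= x <= b -> `|u.[x]| <= `|h x|.
  move=> _; rewrite (ger0_norm (_ : 0 <= h x)) ?mulr_ge0 ?addr_ge0 ?invr_ge0//.
  rewrite /u /h hornerZ normrM ger0_norm ?invr_ge0// ler_wpM2l ?invr_ge0//.
  by rewrite hornerD ler_normD.
have uhE x : a <= x <= b -> `|u.[x]| = `|h x|.
  apply: (realLpN_strict ab r1 (cp u) ch uh); apply/eqP.
  rewrite eq_le (le_realLpN ab r1e (cp u) ch uh)/=.
  by rewrite (le_trans Nh)//; exact: mins.
have du x : a <= x <= b -> `|d.[x]| <= 1 * `|u.[x]|.
  move=> xab; rewrite mul1r uhE// (ger0_norm (_ : 0 <= h x)) ?mulr_ge0 ?addr_ge0 ?invr_ge0//.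
  rewrite /d /h hornerZ normrM ger0_norm ?invr_ge0// ler_wpM2l ?invr_ge0//.
  by rewrite hornerD hornerN ler_normB.
have u0 : u != 0 by rewrite monic_neq0.
have [v [w [uvw w0 vP]]] := itv_root_factorization ab u0.
have vd := vP d 1 du.
have [d0|d0] := eqVneq d 0; first by rewrite sE tE d0 subr0 addr0.
(* A nonzero [d] of degree below n is a multiple of [v], so subtracting [e *: v] from [u] keeps it
   monic of degree n. *)
have sv : (size v <= n)%N by rewrite (leq_trans _ sd)// dvdp_leq.
have [e e0 ew] := horner_gt0_bound ab w0.
have [|mu' su'] := @monicD _ u (- (e *: v)) mu.
  by rewrite size_polyN su ltnS (leq_trans (size_scale_leq _ _)).
have u'E x : (u - e *: v).[x] = v.[x] * (w.[x] - e).
  by rewrite uvw !hornerE; ring.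
have u'u x : a <= x <= b -> `|(u - e *: v).[x]| <= `|u.[x]|.
  move=> xab; rewrite u'E uvw hornerM !normrM ler_wpM2l//.
  have := ew x xab; have := w0 x xab => h1 h2.
  by rewrite !ger0_norm ?subr_ge0 ?(ltW h1)// lerBlDr lerDl ltW.
have Nu : N (fun x => u.[x]) <= N (fun x => (u - e *: v).[x]).
  apply: (@le_trans _ _ (N (fun x => s.[x]))); last first.
    by apply: mins; rewrite ?su'.
  exact: le_trans (le_realLpN ab r1e (cp u) ch uh) Nh.
have u'uE x : a <= x <= b -> `|(u - e *: v).[x]| = `|u.[x]|.
  apply: (realLpN_strict ab r1 (cp _) (cp u) u'u); apply/eqP.
  by rewrite eq_le (le_realLpN ab r1e (cp _) (cp u) u'u).
(* Minimality forces |v| (w - e) = |v| w on [a, b], hence [v] vanishes there. *)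
suff v0 : v = 0 by move: u0; rewrite uvw v0 mul0r eqxx.
apply: (horner_itv_eq0 ab) => x xab; apply/eqP; apply: contraT => vx.
have := u'uE x xab; rewrite u'E uvw hornerM !normrM.
have h1 := w0 x xab; have h2 := ew x xab.
move=> /mulfI; rewrite normr_eq0 => /(_ vx).
rewrite !ger0_norm ?subr_ge0 ?(ltW h1)// => /eqP.
by rewrite subr_eq addrC -subr_eq subrr eq_sym gt_eqF.
Qed.

Lemma minimizer_unique_oo s t : (0 < n)%N ->
  s \is monic -> size s = n.+1 -> t \is monic -> size t = n.+1 ->
  is_minimizer +oo s -> is_minimizer +oo t -> s = t.
Proof.
move=> n0 ms ss mt st mins mint.
pose N f := realLpN +oo a b f.
have cp (p : {poly R}) : continuous (fun x => p.[x]) by exact: continuous_horner.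
pose u := 2^-1 *: (s + t); pose d := 2^-1 *: (s - t).
have [[sE tE] uE] := midpoint s t; rewrite -/u -/d in sE tE uE.
have sd : (size d <= n)%N.
  by rewrite (leq_trans (size_scale_leq _ _))// (size_monicB ms ss mt st).
have [mu su] : (u \is monic) /\ size u = n.+1.
  rewrite uE; have [|m1 ->] := @monicD _ s (- d) ms; last by rewrite ss.
  by rewrite size_polyN ss ltnS.
pose M := N (fun x => s.[x]).
have Nst : N (fun x => t.[x]) = M.
  by apply/eqP; rewrite eq_le mins// mint.
have M0 : 0 < M.
  rewrite lt_neqAle realLpN_ge0 andbT; apply/eqP => /esym M0.
  have := monic_neq0 ms; rewrite (realLpN_horner_eq0 ab _ M0) ?eqxx//.
  by rewrite leey.
(* |u| + |d| is the larger of |u + d| and |u - d|, that is, of |s| and |t|. *)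
have duM x : a <= x <= b -> `|u.[x]| + `|d.[x]| <= M.
  move=> xab; have := norm_le_realLpN_oo ab (cp s) xab.
  have := norm_le_realLpN_oo ab (cp t) xab.
  rewrite -/(N _) Nst -/(N _) -/M {1}tE {1}sE !hornerD hornerN.
  rewrite !ler_norml => /andP[h1 h2] /andP[h3 h4].
  by case: (ger0P u.[x]); case: (ger0P d.[x]); lra.
pose P := (M ^+ 2)%:P - u * u.
have PE x : P.[x] = M ^+ 2 - u.[x] ^+ 2 by rewrite /P hornerD hornerN hornerM hornerC -expr2.
(* M |d| is at most M (M - |u|), hence at most (M + |u|) (M - |u|). *)
have dP x : a <= x <= b -> `|d.[x]| <= M^-1 * `|P.[x]|.
  move=> xab; have h := duM x xab.
  have hB : 0 <= M - `|u.[x]| by rewrite subr_ge0 (le_trans _ h)// lerDl.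
  have hD : 0 <= M + `|u.[x]| by rewrite addr_ge0// ltW.
  rewrite ler_pdivlMl// PE -(real_normK (num_real u.[x])) subr_sqr normrM.
  rewrite (ger0_norm hB) (ger0_norm hD) mulrC ler_pM ?(ltW M0)//.
    by rewrite lerBrDl.
  by rewrite lerDl.
(* Here [0 < n] enters: the square of [u] is not constant. *)
have P0 : P != 0.
  rewrite subr_eq0; apply/eqP => /(congr1 (size \o polyseq)) /=.
  rewrite size_polyC expf_neq0 ?gt_eqF//= size_mul ?monic_neq0// su addnS.
  by case: n n0 {su sd ss st}.
have P_ge0 x : a <= x <= b -> 0 <= P.[x].
  move=> xab; rewrite PE subr_ge0 -(real_normK (num_real u.[x])).
  rewrite ler_sqr ?nnegrE ?(ltW M0)//; apply: le_trans (duM x xab).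
  by rewrite lerDl.
have [v [w [Pvw w0 vP]]] := itv_root_factorization ab P0.
have vd := vP d _ dP.
have [d0|d0] := eqVneq d 0; first by rewrite sE tE d0 subr0 addr0.
have sv : (size v <= n)%N by rewrite (leq_trans _ sd)// dvdp_leq.
have v0 : v != 0 by apply: contraNneq P0 => v0; rewrite Pvw v0 mul0r.
have v_ge0 x : a <= x <= b -> 0 <= v.[x].
  by move=> xab; have := P_ge0 x xab; rewrite Pvw hornerM pmulr_lge0// w0.
have [e e0 ew] := horner_gt0_bound ab w0.
(* Perturbing [u] towards the remainder [r], which agrees with [u] at the
   extremal points, lowers the maximum. *)
pose r := u %% v; pose g := u %/ v.
have sr : (size r <= n)%N by rewrite (leq_trans _ sv)// ltnW// ltn_modp.
have urE : u = g * v + r by exact: divp_eq.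
have [G G0 GP] := horner_bound ab (w + u * g).
have [B B0 BP] := horner_bound ab r.
(* The first bound keeps [w - 2 k (w + u g)] nonnegative on [a, b], the second keeps [k r^2] below
   [M^2]. *)
pose k := Num.min (e / (2 * G)) (M ^+ 2 / B ^+ 2).
have k0 : 0 < k by rewrite lt_min !divr_gt0 ?mulr_gt0 ?exprn_gt0.
have kG : k * (2 * G) <= e.
  by rewrite -ler_pdivlMr ?mulr_gt0// ge_min lexx.
have kB : k * B ^+ 2 <= M ^+ 2.
  by rewrite -ler_pdivlMr ?exprn_gt0// ge_min lexx orbT.
have [|mu' su'] := @monicD _ u (- (k *: r)) mu.
  by rewrite size_polyN su ltnS (leq_trans (size_scale_leq _ _)).
have u'2 x : a <= x <= b -> (u - k *: r).[x] ^+ 2 <= M ^+ 2 * (1 - k).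
  move=> xab.
  have PvwE : M ^+ 2 - u.[x] ^+ 2 = v.[x] * w.[x] by rewrite -PE Pvw hornerM.
  have rE : r.[x] = u.[x] - g.[x] * v.[x].
    by rewrite {1}urE hornerD hornerM addrAC subrr add0r.
  (* Obtained from [r = u - g v] and [u^2 = M^2 - v w]. The first subtracted term is nonnegative and
     the second is at least [k M^2]. *)
  have -> : (u - k *: r).[x] ^+ 2 = M ^+ 2
      - v.[x] * (w.[x] - k * (2 * (w + u * g).[x]))
      - k * (2 * M ^+ 2 - k * r.[x] ^+ 2).
    have -> : (w + u * g).[x] = w.[x] + u.[x] * g.[x] by rewrite hornerD hornerM.
    have -> : (u - k *: r).[x] = u.[x] - k * r.[x] by rewrite hornerD hornerN [(k *: r).[x]]hornerZ.
    have -> : M ^+ 2 = v.[x] * w.[x] + u.[x] ^+ 2 by rewrite -PvwE subrK.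
    by rewrite rE; ring.
  have h1 : 0 <= v.[x] * (w.[x] - k * (2 * (w + u * g).[x])).
    rewrite mulr_ge0 ?v_ge0// subr_ge0 (le_trans _ (ew x xab))//.
    rewrite (le_trans _ kG)// ler_pM2l// ler_pM2l//.
    by rewrite (le_trans (ler_norm _))// GP.
  have h2 : M ^+ 2 <= 2 * M ^+ 2 - k * r.[x] ^+ 2.
    have : k * r.[x] ^+ 2 <= k * B ^+ 2.
      rewrite ler_pM2l// -(real_normK (num_real r.[x])).
      by rewrite ler_sqr ?nnegrE ?(ltW B0)// BP.
    by lra.
  have h3 : k * M ^+ 2 <= k * (2 * M ^+ 2 - k * r.[x] ^+ 2) by rewrite ler_pM2l.
  by lra.
have aab : a <= a <= b by rewrite lexx ltW.
have k1 : 0 <= M ^+ 2 * (1 - k) by rewrite (le_trans _ (u'2 a aab))// sqr_ge0.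
have NM : N (fun x => (u - k *: r).[x]) <= Num.sqrt (M ^+ 2 * (1 - k)).
  apply/(realLpN_oo_leP ab (cp _)); first exact: sqrtr_ge0.
  by move=> x xab; rewrite -sqrtr_sqr ler_sqrt// u'2.
have MM : Num.sqrt (M ^+ 2 * (1 - k)) < M.
  rewrite -[ltRHS](ger0_norm (ltW M0)) -sqrtr_sqr ltr_sqrt ?exprn_gt0//.
  by rewrite gtr_pMr ?exprn_gt0// gtrBl.
have := mins (u - k *: r) mu'; rewrite su' su => /(_ erefl).
by rewrite leNgt (le_lt_trans NM MM).
Qed.

Lemma minimizer_unique q s t : (0 < n)%N -> (1 <= q)%E ->
  s \is monic -> size s = n.+1 -> t \is monic -> size t = n.+1 ->
  is_minimizer q s -> is_minimizer q t -> s = t.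
Proof.
case: q => [r||//] n0 q1; last exact: minimizer_unique_oo.
exact: minimizer_unique_fin.
Qed.

Lemma minimizer_exists q : (1 <= q)%E -> exists t,
  [/\ t \is monic, size t = n.+1 & is_minimizer q t].
Proof.
move=> q1; have cp (p : {poly R}) : continuous (fun x => p.[x]).
  exact: continuous_horner.
apply: (@monic_minimizer _ (fun s => realLpN q a b (fun x => s.[x]))).
- by move=> p; exact: realLpN_ge0.
- move=> p r; under [X in realLpN _ _ _ X <= _]eq_fun do rewrite hornerD.
  exact: realLpND.
- move=> c p; under [X in realLpN _ _ _ X = _]eq_fun do rewrite hornerZ.
  exact: realLpNZ.
- by move=> p; exact: realLpN_horner_eq0.
Qed.

End unique_minimizer.

(** * Extremal functions *)

Section near_extremal_function.
Variables (R : realType) (a b : R).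
Hypothesis ab : a < b.
Notation mu := (@lebesgue_measure R).
Implicit Types (f g phi : R -> R) (p q : \bar R).

(** For [0 <= c], zero when |y| <= c and otherwise [y] moved towards 0 by [c]; the difference of
    positive parts makes continuity immediate. *)
Definition soft_threshold (c y : R) : R := Num.max (y - c) 0 - Num.max (- y - c) 0.

Lemma soft_threshold_continuous c : continuous (soft_threshold c).
Proof.
have cm (h : R -> R) : continuous h -> continuous (fun y => Num.max (h y) 0).
  by move=> ch y; apply: (@continuous_max _ _ h (cst 0)); [exact: ch|exact: cvg_cst].
move=> y; apply: cvgB.
  apply: (cm (fun y => y - c)) => {}y.
  by apply: cvgB; [exact: cvg_id|exact: cvg_cst].
apply: (cm (fun y => - y - c)) => {}y.
by apply: cvgB; [apply: cvgN; exact: cvg_id|exact: cvg_cst].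
Qed.

Lemma norm_soft_threshold c y : 0 <= c ->
  `|soft_threshold c y| = Num.max (`|y| - c) 0.
Proof.
move=> c0; rewrite /soft_threshold.
by case: (lerP 0 y) => y0; case: (lerP 0 (y - c)) => h1; case: (lerP 0 (- y - c)) => h2;
  case: (lerP (`|y| - c) 0); rewrite ?(ger0_norm y0) ?(ltr0_norm y0) => h3;
  rewrite ?subr0 ?sub0r ?subrr ?normrN ?normr0; try lra;
  first [rewrite ger0_norm; lra|rewrite ler0_norm; lra].
Qed.

Lemma soft_threshold_mul c y : 0 <= c ->
  soft_threshold c y * y = `|soft_threshold c y| * `|y|.
Proof.
move=> c0; rewrite -normrM ger0_norm// /soft_threshold.
have [y0|y0] := lerP 0 y.
  rewrite (max_r (_ : - y - c <= 0)) ?subr0; last lra.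
  by rewrite mulr_ge0// le_max lexx orbT.
rewrite (max_r (_ : y - c <= 0)); last lra.
rewrite sub0r mulNr -mulrN mulr_ge0//; last by rewrite oppr_ge0 ltW.
by rewrite le_max lexx orbT.
Qed.

Lemma near_extremal_oo phi c : continuous phi -> 0 <= c -> c < realLpN +oo a b phi ->
  exists2 g, continuous g &
    c * realLpN 1 a b g < \int[mu]_(x in `[a, b]) (g x * phi x).
Proof.
move=> cphi c0 cM; set M := realLpN +oo a b phi in cM.
(* Where [g] is nonzero, |phi| > e, so [g phi] is at least [e |g|]; a threshold strictly between [c]
   and [M] gives the strict inequality and a nonzero [g]. *)
pose e := (c + M) / 2; have e0 : 0 <= e by rewrite /e; lra.
have ce : c < e by rewrite /e; lra.
have eM : e < M by rewrite /e; lra.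
pose g x := soft_threshold e (phi x).
have cg : continuous g.
  move=> x; apply: (@continuous_comp _ _ _ phi); first exact: cphi.
  exact: soft_threshold_continuous.
exists g => //.
have cng : continuous (fun x => `|g x|) by exact: continuous_comp_norm.
have cgphi : continuous (fun x => g x * phi x).
  by move=> x; apply: cvgM; [exact: cg|exact: cphi].
have [z [zab ez]] : exists z, a <= z <= b /\ e < `|phi z|.
  apply: contrapT => h; move: eM; rewrite ltNge => /negP; apply.
  apply/(realLpN_oo_leP ab cphi e0) => x xab; rewrite leNgt; apply/negP => ex.
  by apply: h; exists x.
have g1 : realLpN 1 a b g = \int[mu]_(x in `[a, b]) `|g x|.
  by rewrite /realLpN LpN1E.
have I0 : 0 < \int[mu]_(x in `[a, b]) `|g x|.
  apply: (@Rintegral_continuous_gt0 _ _ _ ab _ z) => //.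
  by rewrite /g norm_soft_threshold// lt_max subr_gt0 ez.
rewrite g1; apply: (@lt_le_trans _ _ (e * \int[mu]_(x in `[a, b]) `|g x|)).
  by rewrite ltr_pM2r.
have ig := continuous_itv_integrable a b cng.
rewrite -RintegralZl//; apply: le_Rintegral => //.
- apply: continuous_itv_integrable => x.
  by apply: cvgM; [exact: cvg_cst|exact: cng].
- exact: continuous_itv_integrable.
- move=> x _; rewrite /g soft_threshold_mul// mulrC norm_soft_threshold//.
  have [h|h] := leP (`|phi x| - e) 0; first by rewrite !mul0r.
  by rewrite ler_wpM2l ?(ltW h)//; lra.
Qed.

Lemma near_extremal_1 phi c : continuous phi -> 0 <= c -> c < realLpN 1 a b phi ->
  exists2 g, continuous g &
    c * realLpN +oo a b g < \int[mu]_(x in `[a, b]) (g x * phi x).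
Proof.
move=> cphi c0 cM; set M := realLpN 1 a b phi in cM.
have ba0 : 0 < b - a by rewrite subr_gt0.
(* Since [g phi] is at least |phi| - e, the integral loses at most [e (b - a)], half of the gap
   between [c] and [M]. *)
pose e := (M - c) / (2 * (b - a)).
have e0 : 0 < e by rewrite divr_gt0 ?mulr_gt0 ?subr_gt0.
have eba : e * (b - a) = (M - c) / 2 by rewrite /e; field; rewrite gt_eqF.
have d0 x : 0 < `|phi x| + e by rewrite ltr_wpDl.
pose g x := phi x / (`|phi x| + e).
have cnp : continuous (fun x => `|phi x|) by exact: continuous_comp_norm.
have cg : continuous g.
  move=> x; apply: cvgM; first exact: cphi.
  apply: cvgV; first by rewrite gt_eqF.
  by apply: cvgD; [exact: cnp|exact: cvg_cst].
exists g => //.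
have g1 : realLpN +oo a b g <= 1.
  apply/(realLpN_oo_leP ab cg) => // x _.
  rewrite /g normrM normfV (ger0_norm (ltW (d0 x))) ler_pdivrMr// mul1r.
  by rewrite lerDl ltW.
have ME : M = \int[mu]_(x in `[a, b]) `|phi x| by rewrite /M /realLpN LpN1E.
apply: (@le_lt_trans _ _ c).
  by rewrite -[leRHS]mulr1 ler_wpM2l.
apply: (@lt_le_trans _ _ (M - e * (b - a))); first by rewrite eba; lra.
have -> : M - e * (b - a) = \int[mu]_(x in `[a, b]) (`|phi x| - e).
  have ie : mu.-integrable `[a, b] (EFin \o (fun _ : R => e)).
    by apply: continuous_itv_integrable => x; exact: cvg_cst.
  have inp := continuous_itv_integrable a b cnp.
  have EB := RintegralB _ inp ie; rewrite {}EB//; congr (_ - _); first exact: ME.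
  by rewrite Rintegral_cst//= lebesgue_measure_itv/= lte_fin ab.
apply: le_Rintegral => //.
- apply: continuous_itv_integrable => x.
  by apply: cvgB; [exact: cnp|exact: cvg_cst].
- apply: continuous_itv_integrable => x.
  by apply: cvgM; [exact: cg|exact: cphi].
- move=> x _; rewrite /g mulrAC ler_pdivlMr// -expr2 -(real_normK (num_real (phi x))).
  rewrite -subr_sqr lerBlDr lerDl; exact: sqr_ge0.
Qed.

Lemma near_extremal_fin (r s : R) phi c : continuous phi -> 1 < r -> 1 < s ->
  r^-1 + s^-1 = 1 -> 0 <= c -> c < realLpN s%:E a b phi ->
  exists2 g, continuous g &
    c * realLpN r%:E a b g < \int[mu]_(x in `[a, b]) (g x * phi x).
Proof.
move=> cphi r1 s1 rs c0 cM.
have r0 : 0 < r by rewrite (lt_trans ltr01).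
have s0 : 0 < s by rewrite (lt_trans ltr01).
have s10 : 0 < s - 1 by rewrite subr_gt0.
have s10' : s - 1 != 0 by rewrite gt_eqF.
(* This exponent identity makes |g|^r equal to |phi|^s, which is also [g phi]. *)
have s1r : (s - 1) * r = s.
  have rE : s + r = s * r by rewrite -[RHS]mulr1 -rs; field; rewrite !gt_eqF.
  by rewrite mulrBl mul1r -rE addrK.
have cm (h : R -> R) : continuous h ->
    continuous (fun x => `|Num.max (h x) 0| `^ (s - 1)).
  move=> ch; apply: continuous_comp_norm_powR => // x.
  by apply: (@continuous_max _ _ h (cst 0)); [exact: ch|exact: cvg_cst].
(* The signed power sgn(phi) |phi|^(s-1), split into positive and negative parts so that its
   continuity needs no sign function. *)
pose g x := `|Num.max (phi x) 0| `^ (s - 1) - `|Num.max (- phi x) 0| `^ (s - 1).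
have cg : continuous g.
  move=> x; apply: cvgB; first exact: (cm phi).
  by apply: (cm (fun x => - phi x)) => y; apply: cvgN; exact: cphi.
have gpos x : 0 <= phi x -> g x = phi x `^ (s - 1).
  move=> h; rewrite /g (max_l h) max_r ?oppr_le0// normr0 powR0// subr0.
  by rewrite (ger0_norm h).
have gneg x : phi x <= 0 -> g x = - (- phi x) `^ (s - 1).
  move=> h; rewrite /g (max_r h) max_l ?oppr_ge0// normr0 powR0// sub0r.
  by rewrite ger0_norm// oppr_ge0.
have gphi x : g x * phi x = `|phi x| `^ s.
  have [h|/ltW h] := leP 0 (phi x).
    by rewrite gpos// (ger0_norm h) mulrC mulr_powRB1.
  rewrite gneg// (ler0_norm h) mulNr -mulrN mulrC mulr_powRB1//.
  by rewrite oppr_ge0.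
have ng x : `|g x| `^ r = `|phi x| `^ s.
  have [h|/ltW h] := leP 0 (phi x).
    by rewrite gpos// (ger0_norm (powR_ge0 _ _)) (ger0_norm h) -powRrM s1r.
  by rewrite gneg// normrN (ger0_norm (powR_ge0 _ _)) (ler0_norm h) -powRrM s1r.
exists g => //.
pose A := \int[mu]_(x in `[a, b]) `|phi x| `^ s.
have A_ge0 : 0 <= A by apply: Rintegral_ge0 => x _; exact: powR_ge0.
have -> : \int[mu]_(x in `[a, b]) (g x * phi x) = A.
  by apply: eq_Rintegral => x _; exact: gphi.
have gE : realLpN r%:E a b g = A `^ r^-1.
  have -> : A = \int[mu]_(x in `[a, b]) `|g x| `^ r.
    by apply: eq_Rintegral => x _; exact: esym (ng x).
  exact: realLpN_EFinE.
have phiE : realLpN s%:E a b phi = A `^ s^-1 by exact: realLpN_EFinE.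
rewrite phiE in cM.
have A0 : 0 < A.
  rewrite lt_neqAle A_ge0 andbT eq_sym; apply/eqP => A0; move: cM.
  by rewrite A0 powR0 ?invr_eq0 ?gt_eqF// ltNge c0.
rewrite gE; apply: (@lt_le_trans _ _ (A `^ s^-1 * A `^ r^-1)).
  by rewrite ltr_pM2r// powR_gt0.
rewrite le_eqVlt; apply/orP; left; apply/eqP.
have sr : s^-1 + r^-1 = 1 by rewrite addrC.
rewrite -powRD sr; first exact: powRr1.
by rewrite oner_eq0.
Qed.

Lemma near_extremal p q phi c : conj_exp p q -> continuous phi -> 0 <= c ->
  c < realLpN q a b phi -> exists2 g, continuous g &
    c * realLpN p a b g < \int[mu]_(x in `[a, b]) (g x * phi x).
Proof.
move=> pq cphi c0.
have [[-> ->]|[-> ->]|[r [s [-> -> r1 s1 rs]]]] := conj_exp_cases pq.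
- exact: near_extremal_oo.
- exact: near_extremal_1.
- exact: near_extremal_fin.
Qed.

End near_extremal_function.

Section iterated_primitives.
Variables (R : realType) (a : R).
Notation mu := (@lebesgue_measure R).

(* The integral from [a - 1] is made constant left of [a - 1/2], so that the
   primitive is continuous everywhere and can be integrated again. *)
Lemma continuous_primitive (g : R -> R) : continuous g ->
  exists2 G, continuous G & forall x, a <= x -> is_derive x (1 : R) G (g x).
Proof.
move=> cg.
pose P x := \int[mu]_(t in `[a - 1, x]) g t.
have dP x : a - 1 < x -> is_derive x (1 : R) P (g x).
  move=> ax; have xx1 : x < x + 1 by rewrite ltrDl.
  have [||d1 d2] := @continuous_FTC1 R g (BLeft (a - 1)) x (x + 1) xx1 _ _ (cg x).
  - exact: continuous_itv_integrable.
  - first [exact: ax | exact: ltW].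
  by apply: DeriveDef; [exact: d1|rewrite -derive1E d2].
pose c := a - 2^-1.
have ac : a - 1 < c by rewrite /c ltrD2l ltrN2 invf_lt1// ltr1n.
exists (fun x => P (Num.max x c)).
  move=> x; apply: (@continuous_comp _ _ _ (fun x => Num.max x c) P).
    by apply: (@continuous_max _ _ id (cst c)); [exact: cvg_id|exact: cvg_cst].
  apply/differentiable_continuous/derivable1_diffP.
  have acx : a - 1 < Num.max x c by rewrite lt_max ac orbT.
  by have [] := dP _ acx.
move=> x ax.
have cx : c < x by rewrite /c (lt_le_trans _ ax)// gtrBl invr_gt0.
apply: near_eq_is_derive (dP x (lt_trans ac cx)).
near=> y; rewrite max_l// ltW//; near: y; exact: lt_nbhsr.
Unshelve. all: by end_near. Qed.

Lemma iterated_primitives (n : nat) (g : R -> R) : continuous g ->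
  exists F : nat -> R -> R, F n = g /\
    forall k, (k < n)%N -> forall x, a <= x -> is_derive x (1 : R) (F k) (F k.+1 x).
Proof.
move=> cg.
(* Primitives are built upwards from [g]; reading the sequence backwards from index [n] turns them
   into derivatives. *)
suff [F [F0 cF dF]] : exists F : nat -> R -> R, [/\ F 0%N = g,
    forall k, continuous (F k) &
    forall k x, a <= x -> is_derive x (1 : R) (F k.+1) (F k x)].
  exists (fun k => F (n - k)%N); split; first by rewrite subnn.
  by move=> k kn x ax; rewrite -subSS (subSn kn); exact: dF.
(* Choice over the type of continuous functions yields a primitive operator that can be iterated. *)
have /choice[I IP] : forall h : {h : R -> R | continuous h},
    exists H : {h : R -> R | continuous h},
      forall x, a <= x -> is_derive x (1 : R) (sval H) (sval h x).
  by move=> [h ch]; have [H cH HP] := continuous_primitive ch; exists (exist _ H cH).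
exists (fun k => sval (iter k I (exist _ g cg))); split => //.
- by move=> k; exact: (svalP (iter k I (exist _ g cg))).
- by move=> k x ax; exact: (IP (iter k I (exist _ g cg))) ax.
Qed.

End iterated_primitives.

(** * The error estimate *)

Section error_estimate.
Variables (R : realType) (n : nat) (a b : R) (p q : \bar R).
Hypotheses (ab : a < b) (pq : conj_exp p q).
Notation mu := (@lebesgue_measure R).
Variables (F : nat -> R -> R) (phi : {poly R}).

Let cphi : continuous (fun x => phi.[x]). Proof. exact: continuous_horner. Qed.

Let q1 : (1 <= q)%E. Proof. by case: pq => _ []. Qed.

Lemma integrable_mul_horner (f : R -> R) :
  measurable_fun `[a, b] f -> (LpN p a b f < +oo)%E ->
  mu.-integrable `[a, b] (EFin \o (fun x => f x * phi.[x])).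
Proof.
move=> mf fp; apply/integrableP; split.
  apply/measurable_EFinP; apply: measurable_funM => //.
  exact: continuous_measurable_fun.
apply: le_lt_trans (LpN_hoelder ab pq mf fp cphi) _.
by rewrite (LpN_continuous_fin ab q1 cphi) lte_mul_pinfty ?LpN_ge0 ?ltry ?ge0_fin_numE ?LpN_ge0//.
Qed.

Hypothesis iFn : mu.-integrable `[a, b] (EFin \o (fun x => F n x * phi.[x])).

Lemma abse_En : (`|En n a b F phi| =
  ((n`!)%:R^-1 * `|\int[mu]_(x in `[a, b]) (F n x * phi.[x])|)%:E)%E.
Proof.
rewrite /En -EFin_Rintegral// -EFinM abse_EFin normrM normf_div normrX normrN1.
by rewrite expr1n div1r (ger0_norm (ler0n _ _)) // mul1r.
Qed.

Lemma abse_En_le : measurable_fun `[a, b] (F n) -> (LpN p a b (F n) < +oo)%E ->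
  (`|En n a b F phi| <=
    LpN p a b (F n) * LpN q a b (fun x => phi.[x]) * ((n`!)%:R^-1)%:E)%E.
Proof.
move=> mf fp; rewrite abse_En mulrC EFinM.
rewrite lee_wpmul2r ?lee_fin ?invr_ge0//.
rewrite EFin_normr_Rintegral//; apply: le_trans (le_abse_integral _ _ _) _ => //.
  by have /integrableP[] := iFn.
exact: (LpN_hoelder ab pq mf fp cphi).
Qed.

End error_estimate.

Section scaling.
Variables (R : realType) (n : nat) (q : \bar R).
Hypothesis q1 : (1 <= q)%E.
Notation mu := (@lebesgue_measure R).

Definition realKconst (t : {poly R}) : R :=
  2 `^ (- n%:R - inv_exp q) * realLpN q (-1) 1 (fun x => t.[x]) / (n`!)%:R.

Let m1_lt1 : (-1 : R) < 1. Proof. by lra. Qed.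

Let fact_gt0R : 0 < (n`!)%:R :> R. Proof. by rewrite ltr0n fact_gt0. Qed.

Lemma KconstE t : Kconst n q t = (realKconst t)%:E.
Proof.
rewrite /Kconst (LpN_continuous_fin m1_lt1 q1); last exact: continuous_horner.
by rewrite -!EFinM.
Qed.

(** The prefactor is positive, so minimizing the constant is minimizing the norm on [-1, 1]. *)
Lemma le_realKconst s t : (realKconst s <= realKconst t) =
  (realLpN q (-1) 1 (fun x => s.[x]) <= realLpN q (-1) 1 (fun x => t.[x])).
Proof. by rewrite /realKconst ler_pM2r ?invr_gt0// ler_pM2l// powR_gt0. Qed.

(** The rescaling of [phi] gives ((b - a)/2)^n and the change of variable ((b - a)/2)^(1/q); the
    powers of 2 are those in the constant. The last two bounds of the theorem are therefore
    equal. *)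
Lemma realLpN_scaling (a b : R) (phi t : {poly R}) : a < b ->
  (forall x, phi.[x] = ((b - a) / 2) ^+ n * t.[(2 * x - a - b) / (b - a)]) ->
  realLpN q a b (fun x => phi.[x]) / (n`!)%:R =
  realKconst t * (b - a) `^ (n%:R + inv_exp q).
Proof.
move=> ab phit; have ba0 : 0 < b - a by rewrite subr_gt0.
have L0 : 0 < (b - a) / 2 by rewrite divr_gt0.
rewrite (realLpN_affine ab q1); last exact: continuous_horner.
have -> : (fun y => phi.[(b - a) / 2 * y + (a + b) / 2]) =
    (fun y => ((b - a) / 2) ^+ n * t.[y]).
  apply/funext => y; rewrite phit; congr (_ * t.[_]).
  by field; rewrite gt_eqF.
rewrite (realLpNZ m1_lt1 _ q1); last exact: continuous_horner.
rewrite normrX (ger0_norm (ltW L0)) -powR_mulrn ?(ltW L0)//.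
set N := realLpN _ _ _ _; rewrite /realKconst -/N.
set x := inv_exp q.
have E : ((b - a) / 2) `^ x * ((b - a) / 2) `^ n%:R =
    (b - a) `^ (n%:R + x) * 2 `^ (- n%:R - x).
  rewrite -powRD; last by rewrite (gt_eqF L0) implybT.
  rewrite powRM ?invr_ge0 ?(ltW ba0)// [x + _]addrC; congr (_ * _).
  by rewrite -(@powR_inv1 _ 2)// -powRrM mulN1r opprD.
by rewrite mulrA E; ring.
Qed.

End scaling.

(** * Sharpness of the estimate *)

Section sharpness.
Variables (R : realType) (n : nat) (p q : \bar R).
Hypotheses (n0 : (0 < n)%N) (pq : conj_exp p q).
Notation mu := (@lebesgue_measure R).

Lemma admissible_primitives (a b : R) (F : nat -> R -> R) : a < b ->
  continuous (F n) ->
  (forall k, (k < n)%N -> forall x, a <= x -> is_derive x (1 : R) (F k) (F k.+1 x)) ->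
  admissible n p a b F.
Proof.
move=> ab cg dF; have p1 : (1 <= p)%E by case: pq.
have n1n : (n.-1 < n)%N by rewrite prednK.
split.
- move=> k kn x; rewrite /= in_itv/= => /andP[ax xb].
  apply: is_derive_deriv_within; apply: dF => //; exact: ltn_trans n1n.
- apply: (derivable_abs_cont_on (ltW ab) _ (df := F n)).
  + apply: derivable_within_continuous => x; rewrite in_itv/= => /andP[ax _].
    by have [] := dF _ n1n x ax.
  + by move=> x /andP[/ltW ax _]; have := dF _ n1n x ax; rewrite prednK.
  + by apply: continuous_subspaceT => x; exact: cg.
- apply/aeW => x; rewrite /= in_itv/= => /andP[/ltW ax _].
  by have := dF _ n1n x ax; rewrite prednK.
- exact: continuous_measurable_fun.
- by rewrite (LpN_continuous_fin ab p1 cg) ltry.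
Qed.

Lemma error_estimate_sharp (a b : R) (phi t : {poly R}) (C : R) : a < b ->
  t != 0 ->
  (forall x, phi.[x] = ((b - a) / 2) ^+ n * t.[(2 * x - a - b) / (b - a)]) ->
  (C%:E < Kconst n q t)%E ->
  exists F : nat -> R -> R, admissible n p a b F /\
    (C%:E * LpN p a b (F n) * ((b - a) `^ (n%:R + inv_exp q))%:E
      < `|En n a b F phi|)%E.
Proof.
move=> ab t0 phit; have [p1 [q1 _]] := pq.
have cphi : continuous (fun x => phi.[x]) by exact: continuous_horner.
rewrite KconstE// lte_fin => CK.
have f0 : 0 < (n`!)%:R :> R by rewrite ltr0n fact_gt0.
set P := (b - a) `^ _.
have P0 : 0 < P by rewrite powR_gt0// subr_gt0.
pose M := realLpN q a b (fun x => phi.[x]).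
have ME : M / (n`!)%:R = realKconst n q t * P by exact: realLpN_scaling.
(* The assumption on [C], restated as a comparison with the norm of [phi] on [a, b]. *)
have CM : C * P * (n`!)%:R < M by rewrite -ltr_pdivlMr// ME ltr_pM2r.
have M0 : 0 < M.
  have -> : M = realKconst n q t * P * (n`!)%:R by rewrite -ME divfK// gt_eqF.
  rewrite !mulr_gt0// /realKconst ?powR_gt0 ?invr_gt0//.
  rewrite lt_neqAle realLpN_ge0 andbT eq_sym; apply: contra t0 => /eqP t0.
  by apply/eqP; apply: realLpN_horner_eq0 t0 => //; lra.
(* [C] may be negative while [near_extremal] takes a nonnegative constant; [M > 0] keeps the maximum
   below [M]. *)
pose c := Num.max (C * P * (n`!)%:R) 0.
have c0 : 0 <= c by rewrite le_max lexx orbT.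
have cM : c < M by rewrite gt_max CM.
have [g cg gP] := near_extremal ab pq cphi c0 cM.
have [F [FnE dF]] := iterated_primitives a n cg.
have cF : continuous (F n) by rewrite FnE.
exists F; split; first exact: admissible_primitives.
have ig : mu.-integrable `[a, b] (EFin \o (fun x => F n x * phi.[x])).
  rewrite FnE; apply: continuous_itv_integrable => x.
  by apply: cvgM; [exact: cg|exact: cphi].
rewrite abse_En// FnE (LpN_continuous_fin ab p1 cg) -!EFinM lte_fin.
rewrite [ltRHS]mulrC ltr_pdivlMr//.
apply: (@le_lt_trans _ _ (c * realLpN p a b g)); last first.
  by apply: lt_le_trans gP _; exact: ler_norm.
have -> : C * realLpN p a b g * P * (n`!)%:R = C * P * (n`!)%:R * realLpN p a b g.
  by ring.
by rewrite ler_wpM2r ?realLpN_ge0// le_max lexx.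
Qed.

End sharpness.

Theorem theorem2p1 (R : realType) (n : nat) (p q : \bar R) :
  (0 < n)%N -> conj_exp p q ->
  (forall (a b : R) (F : nat -> R -> R) (phi phit : {poly R}),
     a < b -> admissible n p a b F ->
     phi \is monic -> size phi = n.+1 ->
     (forall x, phi.[x] = ((b - a) / 2) ^+ n * phit.[(2 * x - a - b) / (b - a)]) ->
     [/\ (\int[@lebesgue_measure R]_(x in [set` `[a, b]]) (F 0%N x)%:E
            = (boundary_part n a b F phi)%:E + En n a b F phi)%E,
         (`|En n a b F phi| <=
            LpN p a b (F n) * LpN q a b (fun x => phi.[x]) * ((n`!)%:R^-1)%:E)%E &
         (LpN p a b (F n) * LpN q a b (fun x => phi.[x]) * ((n`!)%:R^-1)%:E <=
            Kconst n q phit * LpN p a b (F n) *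
              ((b - a) `^ (n%:R + inv_exp q))%:E)%E]) /\
  exists t : {poly R},
    [/\ t \is monic, size t = n.+1,
        (forall s : {poly R}, s \is monic -> size s = n.+1 ->
           (Kconst n q t <= Kconst n q s)%E),
        (forall s : {poly R}, s \is monic -> size s = n.+1 ->
           (forall s' : {poly R}, s' \is monic -> size s' = n.+1 ->
              (Kconst n q s <= Kconst n q s')%E) -> s = t) &
        (forall (a b : R) (phi : {poly R}) (C : R),
           a < b ->
           (forall x, phi.[x] = ((b - a) / 2) ^+ n * t.[(2 * x - a - b) / (b - a)]) ->
           (C%:E < Kconst n q t)%E ->
           exists F : nat -> R -> R, admissible n p a b F /\
             (C%:E * LpN p a b (F n) * ((b - a) `^ (n%:R + inv_exp q))%:E
                < `|En n a b F phi|)%E)].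
Proof.
move=> n0 pq; have [p1 [q1 _]] := pq; split.
  move=> a b F phi phit ab [dF acF aeF mF LpF] mphi sphi phit_phi.
  have iFn := integrable_mul_horner ab pq phi mF LpF.
  split.
  - exact: quadrature_identity.
  - exact: abse_En_le.
  - have cphi : continuous (fun x => phi.[x]) by exact: continuous_horner.
    have LpF_fin : LpN p a b (F n) \is a fin_num by rewrite ge0_fin_numE// LpN_ge0.
    rewrite KconstE// (LpN_continuous_fin ab q1 cphi) -(fineK LpF_fin) -!EFinM lee_fin.
    by rewrite -mulrA (realLpN_scaling q1 ab phit_phi) mulrCA mulrA.
have m1_lt1 : (-1 : R) < 1 by rewrite (lt_trans (ltrN10 _)).
have [t [mt st tP]] := minimizer_exists n m1_lt1 q1.
exists t; split => //.
- by move=> s ms ss; rewrite !KconstE// lee_fin le_realKconst// tP.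
- move=> s ms ss sP; apply: (minimizer_unique m1_lt1 n0 q1) => // s' ms' ss'.
  by have := sP s' ms' ss'; rewrite !KconstE// lee_fin le_realKconst.
- move=> a b phi C ab phit CK.
  by apply: (error_estimate_sharp n0 pq ab _ phit CK); exact: monic_neq0.
Qed.
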